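(* A finite simple graph is $\{P_5,\overline{P_5}\}$-free if and only if it is obtained from pentagons and split graphs by repeated substitutions, split unifications, and split unifications in the complement; that is, if and only if it belongs to the smallest class of graphs that contains all graphs isomorphic to $C_5$ and all split graphs and is closed under substitution (substituting a graph of the class for a vertex of a graph of the class), under taking the split unification of a composable pair of graphs of the class, and under taking a graph whose complement is the split unification of a composable pair $(G_1,G_2)$ with $\overline{G_1},\overline{G_2}$ in the class.
   Context: $P_5$ is the path on 5 vertices, $C_5$ (pentagon) the 5-cycle, $\overline{G}$ the complement of $G$. A graph is $\{P_5,\overline{P_5}\}$-free if it has no induced subgraph isomorphic to $P_5$ or $\overline{P_5}$. A graph is split if its vertex set can be partitioned into a clique and a stable set. Substitution: given vertex-disjoint graphs $G_0$ and $H$ and a vertex $x$ of $G_0$, the graph obtained by substituting $H$ for $x$ has vertex set $V(G_0\setminus x)\cup V(H)$, consists of the union of $G_0\setminus x$ and $H$, plus all edges between $V(H)$ and the neighbors of $x$ in $G_0$. For $S\subseteq V(G)$ and $v\notin S$: $v$ is complete to $S$ if adjacent to all of $S$, anticomplete if adjacent to none, mixed on $S$ otherwise; a set is complete (anticomplete) to a disjoint set if each of its vertices is. An anticomponent of $S$ is a subset of $S$ inducing a connected component of the complement of $G[S]$. Composable pair: let $A,B,C,L,T$ be pairwise disjoint sets with $A,C$ non-empty, and $a^*,c^*$ two distinct vertices not in $A\cup B\cup C\cup L\cup T$. $G_1$ is a graph on $A\cup B\cup L\cup T\cup\{c^*\}$ such that $L$ is a (possibly empty) clique, $T$ is a (possibly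 empty) stable set, $A$ is complete to $B$ and anticomplete to $T$, some vertex of $A$ is complete to $L$, and $c^*$ is complete to $B\cup L$ and anticomplete to $A\cup T$ (other adjacencies arbitrary). $G_2$ is a graph on $B\cup C\cup L\cup T\cup\{a^*\}$ such that $G_2[B\cup L\cup T]=G_1[B\cup L\cup T]$, $T$ is anticomplete to $C$, $L$ is complete to $B\cup C$, $a^*$ is complete to $B\cup L$ and anticomplete to $C\cup T$, some vertex of $C$ is complete to $B$, and no vertex of $C$ is mixed on any anticomponent of $B$ (other adjacencies arbitrary). Its split unification is the graph on $A\cup B\cup C\cup L\cup T$ whose restriction to $A\cup B\cup L\cup T$ is $G_1\setminus c^*$, whose restriction to $B\cup C\cup L\cup T$ is $G_2\setminus a^*$, and in which $A$ is anticomplete to $C$. *)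

(* Defs.v *)
From mathcomp Require Import all_boot.

Set Implicit Arguments.
Unset Strict Implicit.
Unset Printing Implicit Defensive.

Record sgraph (V : finType) := SGraph {
  adj :> rel V;
  adj_sym : symmetric adj;
  adj_irr : irreflexive adj }.

Definition isomorphic (V W : finType) (G : sgraph V) (H : sgraph W) : Prop :=
  exists2 f : V -> W, bijective f & {mono f : x y / G x y >-> H x y}.

Section Basic.
Variables (V : finType) (G : sgraph V).

Definition compl_rel : rel V := fun x y => (x != y) && ~~ G x y.

Lemma compl_sym : symmetric compl_rel.
Proof. by move=> x y; rewrite /compl_rel eq_sym adj_sym. Qed.

Lemma compl_irr : irreflexive compl_rel.
Proof. by move=> x; rewrite /compl_rel eqxx. Qed.

Definition compl : sgraph V := SGraph compl_sym compl_irr.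

Section Induced.
Variable S : {set V}.

Definition induced_rel : rel {x | x \in S} := fun x y => G (val x) (val y).

Lemma induced_sym : symmetric induced_rel.
Proof. by move=> x y; rewrite /induced_rel adj_sym. Qed.

Lemma induced_irr : irreflexive induced_rel.
Proof. by move=> x; rewrite /induced_rel adj_irr. Qed.

Definition induced : sgraph {x | x \in S} := SGraph induced_sym induced_irr.
End Induced.

Definition clique (K : {set V}) : Prop :=
  {in K &, forall x y, x != y -> G x y}.

Definition stable (S : {set V}) : Prop :=
  {in S &, forall x y, ~~ G x y}.

Definition split_graph : Prop :=
  exists K S : {set V},
    [/\ K :|: S = [set: V], [disjoint K & S], clique K & stable S].

Definition vcomplete (x : V) (S : {set V}) : Prop := {in S, forall y, G x y}.

Definition vanticomplete (x : V) (S : {set V}) : Prop :=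
  {in S, forall y, ~~ G x y}.

Definition mixed (x : V) (S : {set V}) : Prop :=
  ~ vcomplete x S /\ ~ vanticomplete x S.

Definition complete (X Y : {set V}) : Prop := {in X, forall x, vcomplete x Y}.

Definition anticomplete (X Y : {set V}) : Prop :=
  {in X, forall x, vanticomplete x Y}.

(* [anti_rel S] is the adjacency of the complement of G[S], seen on V. *)
Definition anti_rel (S : {set V}) : rel V :=
  fun x y => [&& x \in S, y \in S & compl x y].

Definition anticomponent (S X : {set V}) : Prop :=
  exists2 x, x \in S & X = [set y in S | connect (anti_rel S) x y].
End Basic.

Definition contains_induced (V W : finType) (G : sgraph V) (H : sgraph W)
    : Prop :=
  exists S : {set V}, isomorphic (induced G S) H.

Definition P5_rel : rel 'I_5 := fun i j => (i.+1 == j) || (j.+1 == i).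

Lemma P5_sym : symmetric P5_rel.
Proof. by move=> i j; rewrite /P5_rel orbC. Qed.

Lemma P5_irr : irreflexive P5_rel.
Proof. by move=> i; rewrite /P5_rel orbb -[X in _ == X]addn0 -addn1 eqn_add2l. Qed.

Definition P5 : sgraph 'I_5 := SGraph P5_sym P5_irr.

Definition C5_rel : rel 'I_5 :=
  fun i j => (i.+1 %% 5 == j) || (j.+1 %% 5 == i).

Lemma C5_sym : symmetric C5_rel.
Proof. by move=> i j; rewrite /C5_rel orbC. Qed.

Lemma C5_irr : irreflexive C5_rel.
Proof. by case=> [[|[|[|[|[|]]]]]]. Qed.

Definition C5 : sgraph 'I_5 := SGraph C5_sym C5_irr.

Definition P5_antiP5_free (V : finType) (G : sgraph V) : Prop :=
  ~ contains_induced G P5 /\ ~ contains_induced G (compl P5).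

Section Substitution.
Variables (V W : finType) (G0 : sgraph V) (x : V) (H : sgraph W).

Definition subst_rel : rel ({v : V | v != x} + W)%type := fun p q =>
  match p, q with
  | inl u, inl v => G0 (val u) (val v)
  | inl u, inr _ => G0 (val u) x
  | inr _, inl v => G0 x (val v)
  | inr s, inr t => H s t
  end.

Lemma subst_sym : symmetric subst_rel.
Proof. by move=> [u|s] [v|t]; rewrite /= adj_sym. Qed.

Lemma subst_irr : irreflexive subst_rel.
Proof. by move=> [u|s]; rewrite /= adj_irr. Qed.

Definition substitution : sgraph ({v : V | v != x} + W)%type :=
  SGraph subst_sym subst_irr.
End Substitution.

(* The sets A, B, C, L, T and the vertices a*, c* live in an ambient type U.
   A graph whose vertex set is a subset S of U is encoded as [induced G S] for
   some graph G on U: the graphs of the pair are [induced G1 (A ∪ B ∪ L ∪ T ∪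
   {c*})] and [induced G2 (B ∪ C ∪ L ∪ T ∪ {a*})], and the adjacencies of G1
   and G2 outside these sets are irrelevant. *)
Section SplitUnification.
Variables (U : finType) (G1 G2 : sgraph U) (A B C L T : {set U}) (a c : U).

Record composable : Prop := Composable {
  comp_disj : pairwise (fun X Y : {set U} => [disjoint X & Y])
                [:: A; B; C; L; T];
  comp_A : A != set0;
  comp_C : C != set0;
  comp_ac : a != c;
  comp_a : a \notin A :|: B :|: C :|: L :|: T;
  comp_c : c \notin A :|: B :|: C :|: L :|: T;
  comp1_L : clique G1 L;
  comp1_T : stable G1 T;
  comp1_AB : complete G1 A B;
  comp1_AT : anticomplete G1 A T;
  comp1_AL : exists2 x, x \in A & vcomplete G1 x L;
  comp1_c : vcomplete G1 c (B :|: L);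
  comp1_cN : vanticomplete G1 c (A :|: T);
  comp12 : {in B :|: L :|: T &, G2 =2 G1};
  comp2_TC : anticomplete G2 T C;
  comp2_L : complete G2 L (B :|: C);
  comp2_a : vcomplete G2 a (B :|: L);
  comp2_aN : vanticomplete G2 a (C :|: T);
  comp2_CB : exists2 x, x \in C & vcomplete G2 x B;
  comp2_mixed : forall x X, x \in C -> anticomponent G2 B X -> ~ mixed G2 x X }.

Definition part1 : sgraph {x | x \in A :|: B :|: L :|: T :|: [set c]} :=
  induced G1 (A :|: B :|: L :|: T :|: [set c]).

Definition part2 : sgraph {x | x \in B :|: C :|: L :|: T :|: [set a]} :=
  induced G2 (B :|: C :|: L :|: T :|: [set a]).

(* No pair in A x C is contained in either of the two sets below, so A is
   anticomplete to C; on B ∪ L ∪ T the two clauses agree by [comp12]. *)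
Definition unif_rel : rel U := fun x y =>
     [&& x \in A :|: B :|: L :|: T, y \in A :|: B :|: L :|: T & G1 x y]
  || [&& x \in B :|: C :|: L :|: T, y \in B :|: C :|: L :|: T & G2 x y].

Lemma unif_sym : symmetric unif_rel.
Proof.
by move=> x y; rewrite /unif_rel (adj_sym G1) (adj_sym G2); congr (_ || _);
  rewrite andbCA.
Qed.

Lemma unif_irr : irreflexive unif_rel.
Proof. by move=> x; rewrite /unif_rel !adj_irr !andbF. Qed.

Definition split_unification :
    sgraph {x | x \in A :|: B :|: C :|: L :|: T} :=
  induced (SGraph unif_sym unif_irr) (A :|: B :|: C :|: L :|: T).
End SplitUnification.

(* Each operation is closed up to isomorphism, which accounts for the free
   choice of vertex names. *)
Inductive generated : forall V : finType, sgraph V -> Prop :=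
| gen_pentagon (V : finType) (G : sgraph V) :
    isomorphic G C5 -> generated G
| gen_split (V : finType) (G : sgraph V) :
    split_graph G -> generated G
| gen_subst (V V0 W : finType) (G : sgraph V) (G0 : sgraph V0) (x : V0)
    (H : sgraph W) :
    generated G0 -> generated H ->
    isomorphic G (substitution G0 x H) -> generated G
| gen_unif (V U : finType) (G : sgraph V) (G1 G2 : sgraph U)
    (A B C L T : {set U}) (a c : U) :
    composable G1 G2 A B C L T a c ->
    generated (part1 G1 A B L T c) -> generated (part2 G2 B C L T a) ->
    isomorphic G (split_unification G1 G2 A B C L T) -> generated G
| gen_counif (V U : finType) (G : sgraph V) (G1 G2 : sgraph U)
    (A B C L T : {set U}) (a c : U) :
    composable G1 G2 A B C L T a c ->
    generated (compl (part1 G1 A B L T c)) ->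
    generated (compl (part2 G2 B C L T a)) ->
    isomorphic (compl G) (split_unification G1 G2 A B C L T) -> generated G.

(* Main.v *)
Require Import Defs.
From mathcomp Require Import all_boot.

(** For the backward direction, P5 and its complement are prime, so an induced copy
    in a substitution lives in one of the two factors.  In a split unification,
    a copy in which A is complete to L (or C is complete to B) can be moved into
    one of the two parts by collapsing A to a* or C to c*.  Otherwise the copy
    contains an induced P4 a - b - l - c with a, b, l, c in A, B, L, C, and no
    fifth vertex is attached to this P4 in a way compatible with P5 or its
    complement.

    For the converse, argue by induction on the number of vertices.  If the graph
    contains a pentagon, it is a pentagon or the twins of the pentagon's vertices
    yield a homogeneous set.  If it contains no pentagon, then it is split unless
    it or its complement contains two disjoint anticomplete edges.  In that case
    take a minimal set S whose removal leaves two nontrivial components.  Each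
    vertex of S meets every nontrivial component and is mixed on at most one of
    them, so for a nontrivial component D the set L of vertices of S mixed on D
    yields a split unification as soon as L is a clique.  If this fails for two
    components, nonadjacent pairs in the two sets L give two anticomplete
    connected pieces in the complement, and the same construction applied there
    produces an L contained in the union of the trivial components of G - S. *)

Set Implicit Arguments.
Unset Strict Implicit.
Unset Printing Implicit Defensive.

(** * Embeddings and prime patterns *)

Definition embeds (W V : finType) (K : sgraph W) (G : sgraph V) : Prop :=
  exists f : W -> V, {mono f : i j / K i j >-> G i j}.

Lemma embeds_trans (V1 V2 V3 : finType) (G1 : sgraph V1) (G2 : sgraph V2)
    (G3 : sgraph V3) : embeds G1 G2 -> embeds G2 G3 -> embeds G1 G3.
Proof. by move=> [f Hf] [g Hg]; exists (g \o f) => i j /=; rewrite Hg Hf. Qed.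

Lemma isomorphic_sym (V W : finType) (G : sgraph V) (H : sgraph W) :
  isomorphic G H -> isomorphic H G.
Proof.
case=> f [g fK gK] fM; exists g; first by exists f.
by move=> x y; rewrite -fM !gK.
Qed.

Lemma isomorphic_embeds (V W : finType) (G : sgraph V) (H : sgraph W) :
  isomorphic G H -> embeds G H.
Proof. by case=> f _ fM; exists f. Qed.

Lemma embeds_induced (V : finType) (G : sgraph V) (S : {set V}) :
  embeds (induced G S) G.
Proof. by exists val. Qed.

Definition twin_free (W : finType) (K : sgraph W) : Prop :=
  forall i j, K i =1 K j -> i = j.

Lemma twin_free_inj (W V : finType) (K : sgraph W) (G : sgraph V) (f : W -> V) :
  twin_free K -> {mono f : i j / K i j >-> G i j} -> injective f.
Proof. by move=> tK fM i j e; apply: tK => k; rewrite -!fM e. Qed.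

Lemma contains_inducedP (W V : finType) (K : sgraph W) (G : sgraph V) :
  twin_free K -> contains_induced G K <-> embeds K G.
Proof.
move=> tK; split=> [[S iS]|[f fM]].
  exact: embeds_trans (isomorphic_embeds (isomorphic_sym iS)) (embeds_induced _ _).
have fI := twin_free_inj tK fM.
exists [set f i | i in W]; apply: isomorphic_sym.
pose g i : {x | x \in [set f i | i in W]} :=
  exist _ (f i) (imset_f f (isT : i \in W)).
exists g; last by move=> i j; apply: fM.
apply: inj_card_bij; last by rewrite card_sig card_imset.
by move=> i j /(congr1 val) /= /fI.
Qed.

(** Primality in the sense of modular decomposition: every homogeneous set is empty, a singleton or
    everything. *)
Definition prime_graph (W : finType) (K : sgraph W) : Prop :=
  forall p : pred W,
    (forall i j k, p i -> p j -> ~~ p k -> K i k = K j k) ->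
    (forall i j, p i -> p j -> i = j) \/ (forall i, p i).

Notation ord5 k := (@Ordinal 5 k isT).

Lemma forall_ord5 (P : 'I_5 -> Prop) :
  P (ord5 0) -> P (ord5 1) -> P (ord5 2) ->
  P (ord5 3) -> P (ord5 4) -> forall i, P i.
Proof.
move=> P0 P1 P2 P3 P4 [[|[|[|[|[|//]]]]] h].
- by rewrite (_ : Ordinal h = ord5 0) //; apply: val_inj.
- by rewrite (_ : Ordinal h = ord5 1) //; apply: val_inj.
- by rewrite (_ : Ordinal h = ord5 2) //; apply: val_inj.
- by rewrite (_ : Ordinal h = ord5 3) //; apply: val_inj.
by rewrite (_ : Ordinal h = ord5 4) //; apply: val_inj.
Qed.


Lemma prime_P5 : prime_graph P5.
Proof.
move=> p H.
(* A vertex telling two members of [p] apart must lie in [p]. The instances below list every such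
   vertex outside the pair; the 32 subsets are then checked. *)
have D i j k : P5 i k != P5 j k -> p i -> p j -> p k.
  by move=> ne pi pj; apply: contraNT ne => pk; rewrite (H i j k).
have a1 := D (ord5 0) (ord5 1) (ord5 2) isT.
have a2 := D (ord5 0) (ord5 2) (ord5 3) isT.
have a3 := D (ord5 0) (ord5 3) (ord5 1) isT.
have a4 := D (ord5 0) (ord5 3) (ord5 2) isT.
have a5 := D (ord5 0) (ord5 3) (ord5 4) isT.
have a6 := D (ord5 0) (ord5 4) (ord5 1) isT.
have a7 := D (ord5 0) (ord5 4) (ord5 3) isT.
have a8 := D (ord5 1) (ord5 2) (ord5 0) isT.
have a9 := D (ord5 1) (ord5 2) (ord5 3) isT.
have b1 := D (ord5 1) (ord5 3) (ord5 0) isT.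
have b2 := D (ord5 1) (ord5 3) (ord5 4) isT.
have b3 := D (ord5 1) (ord5 4) (ord5 0) isT.
have b4 := D (ord5 1) (ord5 4) (ord5 2) isT.
have b5 := D (ord5 1) (ord5 4) (ord5 3) isT.
have b6 := D (ord5 2) (ord5 3) (ord5 1) isT.
have b7 := D (ord5 2) (ord5 3) (ord5 4) isT.
have b8 := D (ord5 2) (ord5 4) (ord5 1) isT.
have b9 := D (ord5 3) (ord5 4) (ord5 2) isT.
clear D H.
case p0: (p (ord5 0)); case p1: (p (ord5 1)); case p2: (p (ord5 2));
  case p3: (p (ord5 3)); case p4: (p (ord5 4));
  rewrite p0 p1 p2 p3 p4 in a1 a2 a3 a4 a5 a6 a7 a8 a9 b1 b2 b3 b4 b5 b6 b7 b8 b9;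
  try (exfalso; by auto);
  first [ by right; apply: forall_ord5
        | left; apply: forall_ord5; apply: forall_ord5 => //;
          by rewrite ?p0 ?p1 ?p2 ?p3 ?p4 ].
Qed.

Lemma prime_compl (W : finType) (K : sgraph W) :
  prime_graph K -> prime_graph (compl K).
Proof.
move=> pK p H; apply: pK => i j k pi pj pk; have := H i j k pi pj pk.
rewrite /= /compl_rel.
have -> : i != k by apply: contraNneq pk => <-.
have -> : j != k by apply: contraNneq pk => <-.
by move=> /= /negb_inj.
Qed.

(* Two twins would form a nontrivial homogeneous set. *)
Lemma prime_twin_free (W : finType) (K : sgraph W) :
  2 < #|W| -> prime_graph K -> twin_free K.
Proof.
move=> W2 pK i j e.
have [k1 k2 k|H|H] := pK (pred2 i j); last 2 first.
- by apply: H; rewrite /= eqxx ?orbT.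
- suff : #|W| <= 2 by rewrite leqNgt W2.
  rewrite -(@eq_card _ [set i; j]) ?cards2; first by case: (_ != _).
  by move=> k; rewrite !inE; have /= -> := H k.
by move=> /pred2P [] -> /pred2P [] -> _; rewrite ?e.
Qed.

(* Deleting a vertex [n] of P5 or of its complement can leave a path
   [i - j - k - m] only if [n] is attached to it in one of these ways. *)
Definition P4_extension (K : sgraph 'I_5) : Prop :=
  forall i j k m, K i j -> K j k -> K k m -> ~~ K i k -> ~~ K i m -> ~~ K j m ->
  exists n, [:: K n i; K n j; K n k; K n m] \in
    [:: [:: true; false; false; false]; [:: false; false; false; true];
        [:: true; true; false; true]; [:: true; false; true; true]].

Ltac try_ord5 :=
  first [by exists (ord5 0) | by exists (ord5 1) | by exists (ord5 2)
        | by exists (ord5 3) | by exists (ord5 4)].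

Lemma P4_extension_P5 : P4_extension P5.
Proof.
do 4 (apply: forall_ord5); try by []; move=> *; try_ord5.
Qed.

Lemma P4_extension_compl_P5 : P4_extension (compl P5).
Proof.
do 4 (apply: forall_ord5); try by []; move=> *; try_ord5.
Qed.

(** * Closure of the class under the operations *)

Lemma twin_free_P5 : twin_free P5.
Proof. by apply: prime_twin_free prime_P5; rewrite card_ord. Qed.

Lemma twin_free_compl_P5 : twin_free (compl P5).
Proof. by apply: prime_twin_free (prime_compl prime_P5); rewrite card_ord. Qed.

Lemma P5_antiP5_freeP (V : finType) (G : sgraph V) :
  P5_antiP5_free G <-> ~ embeds P5 G /\ ~ embeds (compl P5) G.
Proof.
have h1 := contains_inducedP G twin_free_P5.
have h2 := contains_inducedP G twin_free_compl_P5.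
by rewrite /P5_antiP5_free; tauto.
Qed.

Lemma P5_antiP5_free_embeds (V W : finType) (G : sgraph V) (H : sgraph W) :
  embeds H G -> P5_antiP5_free G -> P5_antiP5_free H.
Proof.
move=> HG /P5_antiP5_freeP [n1 n2]; apply/P5_antiP5_freeP.
by split=> [/embeds_trans /(_ HG)|/embeds_trans /(_ HG)].
Qed.

(** The indices mapped into the copy of [H] form a homogeneous set of [K]. If all are, [H] contains
    the pattern; if at most one is, it can be moved to [x]. *)
Lemma embeds_substitution (W V0 V1 : finType) (K : sgraph W) (G : sgraph V0)
    (x : V0) (H : sgraph V1) :
  prime_graph K -> embeds K (substitution G x H) -> embeds K G \/ embeds K H.
Proof.
move=> pK [f fM].
have [i j k|u1|al] := pK (fun i => if f i is inr _ then true else false).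
- by rewrite -!fM; case: (f i) (f j) (f k) => [?|?] [?|?] [?|?].
- left; exists (fun i => if f i is inl u then val u else x) => i j.
  rewrite -fM; have := u1 i j; case Ei: (f i) => [u|s]; case Ej: (f j) => [v|t] //=.
  by move=> /(_ isT isT) ij; move: Ei; rewrite ij Ej => [[->]]; rewrite !adj_irr.
right; have /fin_all_exists [h hE] : forall i, exists y, f i = inr y.
  by move=> i; have := al i; case: (f i) => // y _; exists y.
by exists h => i j; rewrite -fM !hE.
Qed.

(** * Prime patterns in a split unification *)

Section EmbedsUnification.
Variables (U : finType) (G1 G2 : sgraph U) (A B C L T : {set U}) (a c : U).
Hypothesis comp : composable G1 G2 A B C L T a c.
Variable K : sgraph 'I_5.
Hypotheses (pK : prime_graph K) (eK : P4_extension K).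

Let E := unif_rel G1 G2 A B C L T.

Let E_sym : symmetric E. Proof. exact: unif_sym. Qed.

Let disj : [/\ [disjoint A & C], [disjoint B & C], [disjoint C & L] & [disjoint C & T]].
Proof.
have := comp_disj comp; rewrite /= !andbT.
by move=> /and4P [/and4P [? ? ? ?] /and3P [? ? ?] /andP [? ?] ?]; split.
Qed.

Let disjA : [/\ [disjoint A & B], [disjoint A & L] & [disjoint A & T]].
Proof.
have := comp_disj comp; rewrite /= !andbT.
by move=> /and4P [/and4P [? ? ? ?] /and3P [? ? ?] /andP [? ?] ?]; split.
Qed.

Let notC x : x \in A :|: B :|: L :|: T -> x \notin C.
Proof.
case: disj => d1 d2 d3 d4; rewrite !inE -!orbA => /or4P [] h.
- by rewrite (disjointFr d1 h).
- by rewrite (disjointFr d2 h).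
- by rewrite (disjointFl d3 h).
by rewrite (disjointFl d4 h).
Qed.

Let notA x : x \in B :|: C :|: L :|: T -> x \notin A.
Proof.
case: disj disjA => d1 _ _ _ [d2 d3 d4]; rewrite !inE -!orbA => /or4P [] h.
- by rewrite (disjointFl d2 h).
- by rewrite (disjointFl d1 h).
- by rewrite (disjointFl d3 h).
by rewrite (disjointFl d4 h).
Qed.

Let inBLT x : x \in A :|: B :|: L :|: T -> x \in B :|: C :|: L :|: T ->
  x \in B :|: L :|: T.
Proof. by move=> hx /notA; move: hx; rewrite !inE; case: (x \in A). Qed.

Let E1 x y : x \in A :|: B :|: L :|: T -> y \in A :|: B :|: L :|: T ->
  E x y = G1 x y.
Proof.
move=> hx hy; rewrite /E /unif_rel hx hy /=.
case hx': (x \in B :|: C :|: L :|: T); last by rewrite orbF.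
case hy': (y \in B :|: C :|: L :|: T); last by rewrite orbF.
by rewrite /= (comp12 comp) ?orbb ?inBLT.
Qed.

Let E2 x y : x \in B :|: C :|: L :|: T -> y \in B :|: C :|: L :|: T ->
  E x y = G2 x y.
Proof.
move=> hx hy; rewrite /E /unif_rel hx hy /=.
case hx': (x \in A :|: B :|: L :|: T) => //.
case hy': (y \in A :|: B :|: L :|: T) => //.
by rewrite /= (comp12 comp) ?orbb ?inBLT.
Qed.

Let EAB x y : x \in A -> y \in B -> E x y.
Proof. by move=> hx hy; rewrite E1 ?inE ?hx ?hy ?orbT //; apply: (comp1_AB comp). Qed.

Let EAC x y : x \in A -> y \in C -> E x y = false.
Proof.
move=> hx hy; rewrite /E /unif_rel.
have /negPf -> : x \notin B :|: C :|: L :|: T by apply/negP => /notA; rewrite hx.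
have /negPf -> : y \notin A :|: B :|: L :|: T by apply/negP => /notC; rewrite hy.
by rewrite andbF.
Qed.

Let EAT x y : x \in A -> y \in T -> E x y = false.
Proof.
move=> hx hy; rewrite E1 ?inE ?hx ?hy ?orbT //; apply/negbTE.
exact: (comp1_AT comp).
Qed.

Let ECL x y : x \in C -> y \in L -> E x y.
Proof.
move=> hx hy; rewrite E2 ?inE ?hx ?hy ?orbT // adj_sym.
by apply: (comp2_L comp) => //; rewrite inE hx orbT.
Qed.

Let ECT x y : x \in C -> y \in T -> E x y = false.
Proof.
move=> hx hy; rewrite E2 ?inE ?hx ?hy ?orbT // adj_sym; apply/negbTE.
exact: (comp2_TC comp).
Qed.

Let ELB x y : x \in L -> y \in B -> E x y.
Proof.
move=> hx hy; rewrite E2 ?inE ?hx ?hy ?orbT //.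
by apply: (comp2_L comp) => //; rewrite inE hy.
Qed.

Let ELL x y : x \in L -> y \in L -> x != y -> E x y.
Proof. by move=> hx hy; rewrite E1 ?inE ?hx ?hy ?orbT //; apply: (comp1_L comp). Qed.

Variable g : 'I_5 -> U.
Hypothesis gZ : forall i, g i \in A :|: B :|: C :|: L :|: T.
Hypothesis gM : forall i j, E (g i) (g j) = K i j.

Variant place i : Prop :=
  | PlA of g i \in A | PlB of g i \in B | PlC of g i \in C
  | PlL of g i \in L | PlT of g i \in T.

Let placeP i : place i.
Proof.
have := gZ i; rewrite !inE -!orbA => /or4P [|||/orP []] h;
  by [apply: PlA|apply: PlB|apply: PlC|apply: PlL|apply: PlT].
Qed.

Let embeds_part1 (h : 'I_5 -> U) :
  (forall i, h i \in A :|: B :|: L :|: T :|: [set c]) ->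
  (forall i j, G1 (h i) (h j) = K i j) -> embeds K (part1 G1 A B L T c).
Proof. by move=> hin hM; exists (fun i => exist _ (h i) (hin i)); apply: hM. Qed.

Let embeds_part2 (h : 'I_5 -> U) :
  (forall i, h i \in B :|: C :|: L :|: T :|: [set a]) ->
  (forall i j, G2 (h i) (h j) = K i j) -> embeds K (part2 G2 B C L T a).
Proof. by move=> hin hM; exists (fun i => exist _ (h i) (hin i)); apply: hM. Qed.

Let not_A i : g i \notin A -> g i \in B :|: C :|: L :|: T.
Proof. by have := gZ i; rewrite !inE; case: (g i \in A). Qed.

Let not_C i : g i \notin C -> g i \in A :|: B :|: L :|: T.
Proof. by have := gZ i; rewrite !inE; case: (g i \in C); rewrite //= orbF. Qed.

(** No vertex of the copy outside [A] tells two of its vertices in [A] apart, so primality applies.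
    A single vertex in [A] can be replaced by [a], which has the same adjacencies to the rest of the
    copy. *)
Let collapse_A :
  (forall i j, g i \in A -> g j \in L -> K i j) ->
  embeds K (part1 G1 A B L T c) \/ embeds K (part2 G2 B C L T a).
Proof.
move=> AL; have [i j k pi pj pk|u1|al] := @pK (fun i => g i \in A).
- rewrite -!gM; case: (placeP k) => h; first by rewrite h in pk.
  + by rewrite !EAB.
  + by rewrite !EAC.
  + by rewrite !gM !AL.
  by rewrite !EAT.
- right; pose h i := if g i \in A then a else g i.
  have aE j : g j \notin A -> forall i, g i \in A -> G2 a (g j) = K i j.
    move=> hj i hi; rewrite -gM; case: (placeP j) => h1.
    + by rewrite h1 in hj.
    + by rewrite EAB //; apply: (comp2_a comp); rewrite inE h1.
    + by rewrite EAC //; apply/negbTE; apply: (comp2_aN comp); rewrite inE h1.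
    + by rewrite gM AL //; apply: (comp2_a comp); rewrite inE h1 orbT.
    by rewrite EAT //; apply/negbTE; apply: (comp2_aN comp); rewrite inE h1 orbT.
  apply: (@embeds_part2 h) => [i|i j]; rewrite /h.
    case: ifPn => [_|/not_A]; first by rewrite !inE eqxx orbT.
    by move=> hi; rewrite inE hi.
  case: ifPn => hi; case: ifPn => hj.
  + by rewrite (u1 i j) // !adj_irr.
  + exact: aE.
  + by rewrite adj_sym (aE _ _ j) // adj_sym.
  by rewrite -E2 ?gM // not_A.
left; apply: (@embeds_part1 g) => [i|i j]; first by rewrite !inE al.
by rewrite -gM E1 // !inE al.
Qed.

(** The same argument with [C] and [c]; here only [B] could tell vertices of [C] apart. *)
Let collapse_C :
  (forall i j, g i \in C -> g j \in B -> K i j) ->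
  embeds K (part1 G1 A B L T c) \/ embeds K (part2 G2 B C L T a).
Proof.
move=> CB; have [i j k pi pj pk|u1|al] := @pK (fun i => g i \in C).
- rewrite -!gM; case: (placeP k) => h.
  + by rewrite ![E _ (g k)]E_sym !EAC.
  + by rewrite !gM !CB.
  + by rewrite h in pk.
  + by rewrite !ECL.
  by rewrite !ECT.
- left; pose h i := if g i \in C then c else g i.
  have cE j : g j \notin C -> forall i, g i \in C -> G1 c (g j) = K i j.
    move=> hj i hi; rewrite -gM; case: (placeP j) => h1.
    + by rewrite E_sym EAC //; apply/negbTE; apply: (comp1_cN comp); rewrite inE h1.
    + by rewrite gM CB //; apply: (comp1_c comp); rewrite inE h1.
    + by rewrite h1 in hj.
    + by rewrite ECL //; apply: (comp1_c comp); rewrite inE h1 orbT.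
    by rewrite ECT //; apply/negbTE; apply: (comp1_cN comp); rewrite inE h1 orbT.
  apply: (@embeds_part1 h) => [i|i j]; rewrite /h.
    case: ifPn => [_|/not_C]; first by rewrite !inE eqxx orbT.
    by move=> hi; rewrite inE hi.
  case: ifPn => hi; case: ifPn => hj.
  + by rewrite (u1 i j) // !adj_irr.
  + exact: cE.
  + by rewrite adj_sym (cE _ _ j) // adj_sym.
  by rewrite -E1 ?gM // not_C.
right; apply: (@embeds_part2 g) => [i|i j]; first by rewrite !inE al ?orbT.
by rewrite -gM E2 // !inE al orbT.
Qed.

Lemma embeds_unif_map :
  embeds K (part1 G1 A B L T c) \/ embeds K (part2 G2 B C L T a).
Proof.
have [/existsP [i /existsP [k /and3P [iA kL ik]]]|nAL] :=
  boolP [exists i, [exists k, [&& g i \in A, g k \in L & ~~ K i k]]]; last first.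
  apply: collapse_A => i j iA jL; apply: contraNT nAL => nij.
  by apply/existsP; exists i; apply/existsP; exists j; rewrite iA jL.
have [/existsP [m /existsP [j /and3P [mC jB mj]]]|nCB] :=
  boolP [exists m, [exists j, [&& g m \in C, g j \in B & ~~ K m j]]]; last first.
  apply: collapse_C => i' j iC jB; apply: contraNT nCB => nij.
  by apply/existsP; exists i'; apply/existsP; exists j; rewrite iC jB.
have ij : K i j by rewrite -gM EAB.
have jk : K j k by rewrite -gM E_sym ELB.
have km : K k m by rewrite -gM E_sym ECL.
have im : ~~ K i m by rewrite -gM EAC.
rewrite adj_sym in mj.
(* Each place of [g n] prescribes some entries of its attachment to the path through [A], [B], [L],
   [C], and these conflict with the four patterns of [P4_extension]. *)
have [n] := eK ij jk km ik im mj; rewrite -!gM.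
case: (placeP n) => nP.
- by rewrite (EAB nP jB) (EAC nP mC) !inE; do 2 case: (E _ _).
(* For [n] in [B] only the pattern missing [j] alone survives; then [j] and [n] share an
   anticomponent of [B] on which [m] is mixed. *)
- rewrite [E _ (g i)]E_sym (EAB iA nP) [E _ (g k)]E_sym (ELB kL nP) !inE.
  case nj: (E _ (g j)); case nm: (E _ (g m)) => // _.
  have nBC x : x \in B \/ x \in C -> x \in B :|: C :|: L :|: T.
    by rewrite !inE => -[] ->; rewrite ?orbT.
  have gnj : g j != g n.
    by apply: contraNneq mj => e; rewrite -gM e nm.
  case: (comp2_mixed comp (x := g m)
    (X := [set y in B | connect (anti_rel G2 B) (g j) y]) mC).
    by exists (g j).
  split=> [/(_ (g j))|/(_ (g n))].
    by rewrite inE jB connect0 -E2 ?gM; auto; move=> /(_ isT); rewrite adj_sym (negPf mj).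
  rewrite inE nP connect1; last first.
    rewrite /anti_rel jB nP /= /compl_rel gnj -E2; auto.
    by rewrite E_sym nj.
  by rewrite -E2; auto; rewrite E_sym nm => /(_ isT).
- by rewrite [E _ (g i)]E_sym (EAC iA nP) (ECL nP kL) !inE; do 2 case: (E _ _).
- rewrite (ELB nP jB) [E _ (g m)]E_sym (ECL mC nP).
  have [e|/(ELL nP kL) ->] := eqVneq (g n) (g k); last by rewrite !inE; case: (E _ _).
  by rewrite e [E _ (g i)]E_sym gM (negPf ik) !inE; case: (E _ _).
by rewrite ![E (g n) _]E_sym (EAT iA nP) (ECT mC nP) !inE; do 2 case: (E _ _).
Qed.
End EmbedsUnification.

Lemma embeds_unification (U : finType) (G1 G2 : sgraph U)
    (A B C L T : {set U}) (a c : U) (K : sgraph 'I_5) :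
  composable G1 G2 A B C L T a c -> prime_graph K -> P4_extension K ->
  embeds K (split_unification G1 G2 A B C L T) ->
  embeds K (part1 G1 A B L T c) \/ embeds K (part2 G2 B C L T a).
Proof.
move=> comp pK eK [f fM].
by apply: (embeds_unif_map comp pK eK (g := val \o f)) => [i|//]; apply: valP.
Qed.

Lemma compl_free (V : finType) (G : sgraph V) :
  P5_antiP5_free G -> P5_antiP5_free (compl G).
Proof.
move=> /P5_antiP5_freeP [n1 n2]; apply/P5_antiP5_freeP; split=> -[f fM].
  have fI := twin_free_inj twin_free_P5 fM.
  case: n2; exists f => i j; have := fM i j; rewrite /= /compl_rel /= inj_eq // => <-.
  by case: eqP => [->|_] /=; rewrite ?adj_irr ?negbK.
have fI := twin_free_inj twin_free_compl_P5 fM.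
case: n1; exists f => i j; have := fM i j; rewrite /= /compl_rel inj_eq //.
by case: eqP => [-> _|_ /negb_inj //]; rewrite adj_irr P5_irr.
Qed.

Lemma compl_free_inv (V : finType) (G : sgraph V) :
  P5_antiP5_free (compl G) -> P5_antiP5_free G.
Proof.
move/compl_free; apply: P5_antiP5_free_embeds; exists id => x y.
rewrite /= /compl_rel /= /compl_rel.
by case: eqP => [->|_] /=; rewrite ?adj_irr ?negbK.
Qed.

(** P5 contains two anticomplete edges, each with an endpoint in the clique. Dually, its complement
    contains two nonadjacent pairs complete to each other, each with an endpoint in the stable
    set. *)
Lemma split_graph_free (V : finType) (G : sgraph V) :
  split_graph G -> P5_antiP5_free G.
Proof.
case=> K [S [KS _ cK sS]]; apply/P5_antiP5_freeP.
have KSP x : (x \in K) || (x \in S) by rewrite -in_setU KS inE.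
split=> -[f fM].
  have fI := twin_free_inj twin_free_P5 fM.
  have pickK i j : P5 i j -> exists2 k, k \in [:: i; j] & f k \in K.
    move=> ij; have /orP [h|h] := KSP (f i); first by exists i; rewrite ?inE ?eqxx.
    have /orP [h'|h'] := KSP (f j); first by exists j; rewrite ?inE ?eqxx ?orbT.
    by have := sS _ _ h h'; rewrite fM ij.
  have [i] := pickK (ord5 0) (ord5 1) isT; have [j] := pickK (ord5 3) (ord5 4) isT.
  rewrite !inE => /orP [] /eqP -> h /orP [] /eqP -> h';
    by have := cK _ _ h h'; rewrite (inj_eq fI) fM => /(_ isT).
have fI := twin_free_inj twin_free_compl_P5 fM.
have pickS i j : i != j -> P5 i j -> exists2 k, k \in [:: i; j] & f k \in S.
  move=> ne ij; have /orP [h|h] := KSP (f i); last by exists i; rewrite ?inE ?eqxx.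
  have /orP [h'|h'] := KSP (f j); last by exists j; rewrite ?inE ?eqxx ?orbT.
  by have := cK _ _ h h'; rewrite inj_eq // fM /= /compl_rel ij andbF ne => /(_ isT).
have [i] := pickS (ord5 0) (ord5 1) isT isT; have [j] := pickS (ord5 3) (ord5 4) isT isT.
rewrite !inE => /orP [] /eqP -> h /orP [] /eqP -> h';
  by have := sS _ _ h h'; rewrite fM.
Qed.

(** A degree count: in C5 every vertex has two neighbours and two other non-neighbours, while an end
    of P5 has three non-neighbours, hence three neighbours in the complement. *)
Lemma C5_free : P5_antiP5_free C5.
Proof.
have nb : forall x y z t : 'I_5, C5 x y -> C5 x z -> C5 x t -> [|| y == z, y == t | z == t].
  by do 4 (apply: forall_ord5).
have nn : forall x y z t : 'I_5, ~~ C5 x y -> ~~ C5 x z -> ~~ C5 x t ->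
   [|| x == y, x == z, x == t, y == z, y == t | z == t].
  by do 4 (apply: forall_ord5).
apply/P5_antiP5_freeP; split=> -[f fM].
  have fI := twin_free_inj twin_free_P5 fM.
  have := nn (f (ord5 0)) (f (ord5 2)) (f (ord5 3)) (f (ord5 4)); rewrite !fM !(inj_eq fI) /=.
  by move=> /(_ isT isT isT).
have fI := twin_free_inj twin_free_compl_P5 fM.
have := nb (f (ord5 0)) (f (ord5 2)) (f (ord5 3)) (f (ord5 4)); rewrite !fM !(inj_eq fI) /=.
by move=> /(_ isT isT isT).
Qed.

Lemma generated_free (V : finType) (G : sgraph V) :
  generated G -> P5_antiP5_free G.
Proof.
elim=> {V G}.
- by move=> V G /isomorphic_embeds /P5_antiP5_free_embeds; apply; apply: C5_free.
- exact: split_graph_free.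
- move=> V V0 W G G0 x H _ /P5_antiP5_freeP [a1 a2] _ /P5_antiP5_freeP [b1 b2].
  move=> /isomorphic_embeds /P5_antiP5_free_embeds; apply; apply/P5_antiP5_freeP.
  split; first by move=> /(embeds_substitution prime_P5) [].
  by move=> /(embeds_substitution (prime_compl prime_P5)) [].
- move=> V U G G1 G2 A B C L T a c comp _ /P5_antiP5_freeP [a1 a2].
  move=> _ /P5_antiP5_freeP [b1 b2].
  move=> /isomorphic_embeds /P5_antiP5_free_embeds; apply; apply/P5_antiP5_freeP.
  split; first by move=> /(embeds_unification comp prime_P5 P4_extension_P5) [].
  by move=> /(embeds_unification comp (prime_compl prime_P5) P4_extension_compl_P5) [].
move=> V U G G1 G2 A B C L T a c comp _ /compl_free_inv /P5_antiP5_freeP [a1 a2].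
move=> _ /compl_free_inv /P5_antiP5_freeP [b1 b2] iso; apply: compl_free_inv.
apply: P5_antiP5_free_embeds (isomorphic_embeds iso) _; apply/P5_antiP5_freeP.
split; first by move=> /(embeds_unification comp prime_P5 P4_extension_P5) [].
by move=> /(embeds_unification comp (prime_compl prime_P5) P4_extension_compl_P5) [].
Qed.

(** * Components left by a vertex cutset *)

Ltac adjdone := first [done | by rewrite adj_sym].

Section Patterns.
Variables (V : finType) (G : sgraph V).

Definition no_P5 : Prop := forall a b c d e,
  G a b -> G b c -> G c d -> G d e -> ~~ G a c -> ~~ G a d -> ~~ G a e ->
  ~~ G b d -> ~~ G b e -> ~~ G c e -> False.

(* The complement of P5: the 4-cycle [a b c d] with a roof [e] on [a b]. *)
Definition no_house : Prop := forall a b c d e,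
  G a b -> G b c -> G c d -> G d a -> G e a -> G e b ->
  ~~ G a c -> ~~ G b d -> ~~ G e c -> ~~ G e d -> False.

(** The nonedges are listed in cyclic order, so that a rotation only permutes the conjuncts. *)
Definition pentagon a b c d e : bool :=
  [&& G a b, G b c, G c d, G d e, G e a,
      ~~ G a c, ~~ G b d, ~~ G c e, ~~ G d a & ~~ G e b].

Lemma free_no_P5 : P5_antiP5_free G -> no_P5.
Proof.
case/P5_antiP5_freeP=> nP _ a b c d e ab bc cd de ac ad ae bd be ce; apply: nP.
exists (fun i : 'I_5 => nth a [:: a; b; c; d; e] i).
by apply: forall_ord5; apply: forall_ord5; rewrite /= ?adj_irr //;
  first [exact/negbTE | rewrite adj_sym //; exact/negbTE].
Qed.

Lemma free_no_house : P5_antiP5_free G -> no_house.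
Proof.
case/P5_antiP5_freeP=> _ nH a b c d e ab bc cd da ea eb ac bd ec ed; apply: nH.
(* The complement of the house is the path [a - c - e - d - b]. *)
exists (fun i : 'I_5 => nth a [:: a; c; e; d; b] i).
by apply: forall_ord5; apply: forall_ord5; rewrite /= ?adj_irr //;
  first [exact/negbTE | rewrite adj_sym //; exact/negbTE].
Qed.
End Patterns.

Lemma compl_pentagon (V : finType) (G : sgraph V) a b c d e :
  pentagon (compl G) a b c d e -> pentagon G a c e b d.
Proof.
rewrite /pentagon => /and5P [ab bc cd de /and5P [ea ac bd ce /andP [da eb]]].
have nE x y : ~~ compl G x y -> x = y \/ G x y.
  by rewrite /= /compl_rel negb_and !negbK => /orP [/eqP|]; [left|right].
(* Failure of complement adjacency also allows [x = y]; a vertex [z] adjacent in the complement to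
   [y] but not to [x] excludes this. *)
have edge x y z : ~~ compl G x y -> compl G y z -> ~~ compl G x z -> G x y.
  by move=> /nE [->|//] h; rewrite h.
have nonedge x y : compl G x y -> ~~ G x y by case/andP.
rewrite (edge a c d) ?(edge c e a) ?(edge e b c) ?(edge b d e) ?(edge d a b) //;
  try (by rewrite // adj_sym).
by rewrite !nonedge // adj_sym.
Qed.

Definition house_P5_C5_free (V : finType) (G : sgraph V) : Prop :=
  [/\ no_P5 G, no_house G & forall a b c d e, ~~ pentagon G a b c d e].

Section Connectivity.
Variables (V : finType) (G : sgraph V).
Implicit Types (S D : {set V}) (x y : V).

(** Connectedness through cuts, the form that locates an edge whose ends a given vertex
    distinguishes. *)
Definition connected_set (D : {set V}) : Prop := forall (X : pred V) x y,
  x \in D -> y \in D -> X x -> ~~ X y ->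
  exists p q, [/\ p \in D, q \in D, X p, ~~ X q & G p q].

Definition avoid_rel (S : {set V}) : rel V :=
  fun x y => [&& x \notin S, y \notin S & G x y].

Definition component (S : {set V}) (x : V) : {set V} :=
  [set y | connect (avoid_rel S) x y].

Definition nontrivial (S : {set V}) (x : V) : bool :=
  (x \notin S) && [exists y, (y \notin S) && G x y].

(** Anchoring one of the two nontrivial components at [x] keeps track of it when [S] is
    minimised. *)
Definition separates (x : V) (S : {set V}) : bool :=
  nontrivial S x && [exists y, nontrivial S y && (y \notin component S x)].

Definition touching (S : {set V}) : Prop := forall s y,
  s \in S -> nontrivial S y -> exists2 z, z \in component S y & G s z.

Lemma avoid_connect_sym S : connect_sym (avoid_rel S).
Proof.
by apply: sym_connect_sym => x y; rewrite /avoid_rel adj_sym andbCA.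
Qed.

Lemma component_refl S x : x \in component S x.
Proof. by rewrite inE connect0. Qed.

Lemma component_sub S x (D : {set V}) : x \in D ->
  (forall p q, avoid_rel S p q -> p \in D -> q \in D) -> component S x \subset D.
Proof.
move=> xD Dcl; apply/subsetP => y; rewrite inE => xy.
by rewrite -(closed_connect (intro_closed (avoid_connect_sym S) Dcl) xy).
Qed.

Lemma component_notin S x y : x \notin S -> y \in component S x -> y \notin S.
Proof.
move=> xS; suff /subsetP h : component S x \subset ~: S by move=> /h; rewrite inE.
by apply: component_sub; [rewrite inE | move=> p q /and3P [_ qS _] _; rewrite inE].
Qed.

Lemma component_eq S x y : y \in component S x -> component S y = component S x.
Proof.
rewrite inE => xy; apply/setP => z; rewrite !inE.
by rewrite (same_connect (avoid_connect_sym S) xy).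
Qed.

Lemma component_sym S x y : (y \in component S x) = (x \in component S y).
Proof. by rewrite !inE avoid_connect_sym. Qed.

Lemma component_step S x p q : p \notin S -> q \notin S -> G p q ->
  p \in component S x -> q \in component S x.
Proof.
rewrite !inE => pS qS pq xp; apply: connect_trans xp (connect1 _).
by rewrite /avoid_rel pS qS.
Qed.

Lemma component_anticomplete S x y : x \notin S -> y \notin S ->
  y \notin component S x -> anticomplete G (component S x) (component S y).
Proof.
move=> xS yS yx p px q qy; apply: contra yx => pq.
have pS := component_notin xS px; have qS := component_notin yS qy.
rewrite -(component_eq (component_step pS qS pq px)).
by rewrite component_sym.
Qed.

Lemma component_connected S x : x \notin S -> connected_set (component S x).
Proof.
move=> xS X y z yx zx Xy nXz.
have [/existsP [p /existsP [q /and5P [px qx Xp nXq pq]]]|nex] :=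
  boolP [exists p, [exists q,
    [&& p \in component S x, q \in component S x, X p, ~~ X q & G p q]]].
  by exists p, q.
suff /subsetP /(_ z) : component S y \subset [set w in component S x | X w].
  by rewrite (component_eq yx) zx inE (negPf nXz) andbF => /(_ isT).
apply: component_sub; first by rewrite inE yx.
move=> p q /and3P [pS qS pq]; rewrite !inE -![connect _ _ _](in_set (connect _ x)).
case/andP=> px Xp; have qx := component_step pS qS pq px.
rewrite qx /=; apply: contraNT nex => nXq.
by apply/existsP; exists p; apply/existsP; exists q; rewrite px qx Xp nXq.
Qed.

Lemma nontrivial_notin S x : nontrivial S x -> x \notin S.
Proof. by case/andP. Qed.

Lemma nontrivial_component S x y : nontrivial S x -> y \in component S x ->
  nontrivial S y.
Proof.
case/andP=> xS /existsP [z /andP [zS xz]] yx; rewrite /nontrivial.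
have yS := component_notin xS yx; rewrite yS /=.
have [->|yx'] := eqVneq y x; first by apply/existsP; exists z; rewrite zS.
have nyx : ~~ pred1 y x by rewrite /= eq_sym.
have [p [q [px qx /eqP <- ne pq]]] :=
  @component_connected S x xS (pred1 y) y x yx (component_refl S x) (eqxx y) nyx.
by apply/existsP; exists q; rewrite pq (component_notin xS qx).
Qed.

Lemma nontrivial_card S x : nontrivial S x -> 1 < #|component S x|.
Proof.
case/andP=> xS /existsP [z /andP [zS xz]]; apply/card_gt1P; exists x, z.
split; first exact: component_refl.
  exact: component_step xz (component_refl _ _).
by apply: contraTneq xz => ->; rewrite adj_irr.
Qed.

Lemma nontrivial_sub (S S' : {set V}) x : S' \subset S -> nontrivial S x -> nontrivial S' x.
Proof.
move=> /subsetP sS /andP [xS /existsP [y /andP [yS xy]]].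
rewrite /nontrivial (contra (sS x) xS); apply/existsP; exists y.
by rewrite xy (contra (sS y) yS).
Qed.

(* If [s] missed a nontrivial component, that component would survive the
   removal of [s] from [S], and [S :\ s] would still separate. *)
Lemma minset_touching x S : minset (separates x) S -> touching S.
Proof.
case/minsetP=> /andP [ntx /existsP [w /andP [ntw wx]]] Smin s y sS nty.
have [/exists_inP [z zy sz]|none] := boolP [exists z in component S y, G s z].
  by exists z.
have xS := nontrivial_notin ntx; have yS := nontrivial_notin nty.
have sub : S :\ s \subset S by exact: subD1set.
have cl y' : y' \in component S y -> component (S :\ s) y' \subset component S y.
  move=> y'y; apply: component_sub => // p q /and3P [pS qS pq] py.
  have pS' := component_notin yS py.
  have qs : q != s.
    apply: contraNneq none => qs; apply/exists_inP; exists p => //.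
    by rewrite adj_sym -qs.
  by apply: (component_step pS' _ pq py); move: qS; rewrite !inE qs.
have : separates x (S :\ s).
  rewrite /separates (nontrivial_sub sub) //=; apply/existsP.
  have [yx|yx] := boolP (y \in component S x).
    exists w; rewrite (nontrivial_sub sub) //=; apply: contra wx => wx.
    by rewrite -(component_eq yx) (subsetP (cl x _)) // component_sym.
  exists y; rewrite (nontrivial_sub sub) //=; apply: contra yx => yx.
  by rewrite component_sym (subsetP (cl y _)) ?component_refl // component_sym.
by move=> /Smin /(_ sub) e; move: sS; rewrite -e !inE eqxx.
Qed.
End Connectivity.

(** * From a cutset to a split divide *)

Section Attachment.
Variables (V : finType) (G : sgraph V).
Implicit Types (D M S : {set V}).

(** Otherwise adjacency to [u] changes along an edge of [D] and along an edge of [D'], and these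
    edges joined through [u] form an induced P5. *)
Lemma mixed_complete D D' u x y z : no_P5 G ->
  connected_set G D -> connected_set G D' -> anticomplete G D D' ->
  x \in D -> G u x -> y \in D -> ~~ G u y -> z \in D' -> G u z ->
  vcomplete G u D'.
Proof.
move=> nP cD cD' DD' xD ux yD uy zD' uz w wD'; apply/negPn/negP => uw.
have [p [q [pD qD up uq pq]]] := cD (G u) x y xD yD ux uy.
have [p' [q' [pD' qD' up' uq' pq']]] := cD' (G u) z w zD' wD' uz uw.
have a1 := DD' _ qD _ pD'; have a2 := DD' _ qD _ qD'.
have a3 := DD' _ pD _ pD'; have a4 := DD' _ pD _ qD'.
by apply: (nP q p u p' q'); adjdone.
Qed.

Lemma near_neighbor D u d x a : no_P5 G ->
  connected_set G D -> vanticomplete G d D -> G u d -> x \in D -> G u x ->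
  a \in D -> ~~ G u a -> exists p, [/\ p \in D, G u p & G p a].
Proof.
move=> nP cD dD ud xD ux aD ua.
pose X v := G u v || [exists w, [&& w \in D, G u w & G w v]].
have [Xa|nXa] := boolP (X a).
  by case/orP: Xa => [h|/existsP [p /and3P [? ? ?]]]; [rewrite h in ua | exists p].
have [|p [q [pD qD Xp nXq pq]]] := cD X x a xD aD _ nXa; first by rewrite /X ux.
move: nXq; rewrite /X negb_or => /andP [uq /existsPn nq].
have up : ~~ G u p.
  by apply/negP => up; move: (nq p); rewrite pD up pq.
move: Xp; rewrite /X (negPf up) => /existsP [w /and3P [wD uw wp]].
have qw : ~~ G w q by move: (nq w); rewrite wD uw.
have dq := dD _ qD; have dp := dD _ pD; have dw := dD _ wD.
by case: (nP q p w u d); adjdone.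
Qed.

(** If [p] saw only [u], then [near_neighbor] would yield a neighbour [q] of [p] seen by [u']. When
    [u] sees [q], the cycle [u q u' d] with roof [p] is a house; otherwise [p q u' d u] is a
    pentagon. *)
Lemma nonadjacent_agree D u u' d x x' : house_P5_C5_free G ->
  connected_set G D -> vanticomplete G d D -> G u d -> G u' d -> ~~ G u u' ->
  x \in D -> G u x -> x' \in D -> G u' x' -> {in D, G u =1 G u'}.
Proof.
move=> [nP nH nC] cD dD.
have half v v' y y' : G v d -> G v' d -> ~~ G v v' -> y \in D -> G v y ->
    y' \in D -> G v' y' -> forall p, p \in D -> G v p -> G v' p.
  move=> vd v'd vv' yD vy y'D v'y' p pD vp; apply/negPn/negP => v'p.
  have [q [qD v'q qp]] := near_neighbor nP cD dD v'd y'D v'y' pD v'p.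
  have dp := dD _ pD; have dq := dD _ qD.
  have [vq|vq] := boolP (G v q).
    by apply: (nH v q v' d p); adjdone.
  by have /negP := nC p q v' d v; apply; do 9! (apply/andP; split; first adjdone); adjdone.
move=> ud u'd uu' xD ux x'D u'x' p pD; apply/idP/idP.
  exact: (half u u' x x').
by apply: (half u' u x' x); adjdone.
Qed.

(* A vertex of [D] with the most neighbours in [M]: if it missed [u] in [M], it
   would have a neighbour [p] in [D] adjacent to [u], and [p] would miss some
   neighbour [u'] of it, giving a house with roof [d]. *)
Lemma dominating_vertex D M d x0 : house_P5_C5_free G ->
  connected_set G D -> vanticomplete G d D -> x0 \in D ->
  {in M, forall u, G u d} -> {in M, forall u, exists2 x, x \in D & G u x} ->
  exists2 a, a \in D & vcomplete G a M.
Proof.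
move=> Gf cD dD x0D Md MD; have [nP nH nC] := Gf.
case: (@arg_maxnP V x0 (mem D) (fun a => #|[set u in M | G u a]|) x0D) => a aD amax.
exists a => // u uM; apply/negPn/negP => au.
have [x xD ux] := MD _ uM.
have ua : ~~ G u a by rewrite adj_sym.
have [p [pD up pa]] := near_neighbor nP cD dD (Md _ uM) xD ux aD ua.
have [/existsP [u' /and3P [u'M u'a u'p]]|none] :=
    boolP [exists u', [&& u' \in M, G u' a & ~~ G u' p]].
  have [uu'|uu'] := boolP (G u u').
    have := dD _ pD; have := dD _ aD; have := Md _ uM; have := Md _ u'M.
    by move=> *; apply: (nH u u' a p d); adjdone.
  (* For nonadjacent [u] and [u'] there is no such house, but [p] would tell them apart. *)
  have [x' x'D u'x'] := MD _ u'M.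
  have := nonadjacent_agree Gf cD dD (Md _ uM) (Md _ u'M) uu' xD ux x'D u'x' pD.
  by rewrite up (negPf u'p).
have : #|[set w in M | G w p]| <= #|[set w in M | G w a]| := amax p pD.
rewrite leqNgt => /negP; apply; apply: proper_card.
apply/properP; split.
  apply/subsetP => w; rewrite !inE => /andP [wM wa]; rewrite wM /=.
  by apply: contraNT none => wp; apply/existsP; exists w; rewrite wM wa.
by exists u; rewrite !inE uM ?up.
Qed.
End Attachment.

(** A split unification described without marker vertices. [divide_agree] is the local form of the
    anticomponent condition; the bounds on [#|A|] and [#|C|] make each part, marker included,
    smaller than [G]. *)
Record split_divide (V : finType) (G : sgraph V) (A B C L T : {set V}) : Prop :=
  SplitDivide {
  divide_disj : pairwise (fun X Y : {set V} => [disjoint X & Y]) [:: A; B; C; L; T];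
  divide_cover : A :|: B :|: C :|: L :|: T = setT;
  divide_A : 1 < #|A|;
  divide_C : 1 < #|C|;
  divide_L : clique G L;
  divide_T : stable G T;
  divide_AB : complete G A B;
  divide_AC : anticomplete G A C;
  divide_AT : anticomplete G A T;
  divide_AL : exists2 x, x \in A & vcomplete G x L;
  divide_LC : complete G L C;
  divide_TC : anticomplete G T C;
  divide_LB : complete G L B;
  divide_CB : exists2 x, x \in C & vcomplete G x B;
  divide_agree : forall x b b', x \in C -> b \in B -> b' \in B ->
    ~~ G b b' -> G x b = G x b' }.

Section Divide.
Variables (V : finType) (G : sgraph V).
Hypothesis Gf : house_P5_C5_free G.
Implicit Types (S D : {set V}).

(** Under [touching], and for a nontrivial component [D] of [G - S], these are the vertices of [S]
    mixed on [D]. *)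
Definition incomplete_to (S D : {set V}) : {set V} :=
  [set s in S | ~~ [forall y in D, G s y]].

Lemma incomplete_toP S D s : reflect (s \in S /\ exists2 y, y \in D & ~~ G s y)
  (s \in incomplete_to S D).
Proof.
rewrite inE negb_forall_in; apply: (iffP andP) => -[sS].
  by case/exists_inP=> y yD sy; split=> //; exists y.
by case=> y yD sy; split=> //; apply/exists_inP; exists y.
Qed.

Lemma incomplete_complete S x y s : touching G S ->
  nontrivial G S x -> nontrivial G S y -> y \notin component G S x ->
  s \in incomplete_to S (component G S x) -> vcomplete G s (component G S y).
Proof.
move=> tS ntx nty yx /incomplete_toP [sS [p px sp]].
have [nP _ _] := Gf; have xS := nontrivial_notin ntx; have yS := nontrivial_notin nty.
have [q qx sq] := tS _ _ sS ntx; have [z zy sz] := tS _ _ sS nty.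
exact: (mixed_complete nP (component_connected xS) (component_connected yS)
  (component_anticomplete xS yS yx) qx sq px sp zy sz).
Qed.

(** [C] collects the other nontrivial components and [T] the isolated vertices of [G - S]. The
    adjacencies that are not immediate come from the attachment lemmas, with a vertex of the
    opposite side in the role of [d]. *)
Lemma component_split_divide S x y : touching G S ->
  nontrivial G S x -> nontrivial G S y -> y \notin component G S x ->
  clique G (incomplete_to S (component G S x)) ->
  exists A B C L T, split_divide G A B C L T.
Proof.
move=> tS ntx nty yx cL; have [nP nH nC] := Gf.
have xS := nontrivial_notin ntx; have yS := nontrivial_notin nty.
set A := component G S x in yx cL *; set L := incomplete_to S A in cL.
pose B := S :\: L; pose C := [set z | nontrivial G S z] :\: A.
pose T := [set z | z \notin S] :\: [set z | nontrivial G S z].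
have AnS z : z \in A -> z \notin S := component_notin xS.
have Ant z : z \in A -> nontrivial G S z by move=> zA; apply: nontrivial_component zA.
have LS z : z \in L -> z \in S by case/incomplete_toP.
have BS z : z \in B -> z \in S by case/setDP.
have CP z : z \in C -> nontrivial G S z /\ z \notin A by case/setDP; rewrite inE.
have TP z : z \in T -> z \notin S /\ ~~ nontrivial G S z by case/setDP; rewrite !inE.
have BA b z : b \in B -> z \in A -> G b z.
  case/setDP=> bS bL zA; apply/negPn/negP => bz; case/negP: bL.
  by apply/incomplete_toP; split=> //; exists z.
have LC l z : l \in L -> z \in C -> G l z.
  move=> lL /CP [ntz zA].
  by apply: (incomplete_complete tS ntx ntz zA lL); apply: component_refl.
have xanti z : z \in C -> anticomplete G A (component G S z).
  by case/CP=> ntz zA; apply: component_anticomplete => //; apply: nontrivial_notin ntz.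
have xA : x \in A by apply: component_refl.
have yC : y \in C by rewrite in_setD yx inE.
have yanti : vanticomplete G y A.
  by move=> z zA; rewrite adj_sym; apply: (xanti y) => //; apply: component_refl.
exists A, B, C, L, T; split.
- rewrite /= !andbT; apply/and4P; split;
    [apply/and4P; split | apply/and3P; split | apply/andP; split | ];
    rewrite -setI_eq0; apply/eqP/setP => z; rewrite in_set0; apply/negP; case/setIP.
  + by move=> /AnS zS /BS; apply/negP.
  + by move=> zA /CP []; rewrite zA.
  + by move=> /AnS zS /LS; apply/negP.
  + by move=> /Ant zS /TP [_]; rewrite zS.
  + by move=> /BS zS /CP [/nontrivial_notin]; rewrite zS.
  + by case/setDP=> _ /negP.
  + by move=> /BS zS /TP []; rewrite zS.
  + by move=> /CP [/nontrivial_notin zS _] /LS; apply/negP.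
  + by move=> /CP [zS _] /TP [_]; rewrite zS.
  by move=> /LS zS /TP []; rewrite zS.
- apply/setP => z; rewrite in_setT.
  have [zS|zS] := boolP (z \in S); have [zL|zL] := boolP (z \in L).
  + by rewrite !in_setU zL ?orbT.
  + by rewrite !in_setU in_setD zS zL ?orbT.
  + by rewrite !in_setU zL ?orbT.
  have [zA|zA] := boolP (z \in A); first by rewrite !in_setU zA.
  have [nz|nz] := boolP (nontrivial G S z).
    by rewrite !in_setU /C in_setD zA inE nz ?orbT.
  by rewrite !in_setU /T in_setD !inE nz zS ?orbT.
- exact: nontrivial_card.
- apply: leq_trans (nontrivial_card nty) (subset_leq_card _); apply/subsetP => z zy.
  rewrite in_setD inE (nontrivial_component nty zy) andbT.
  by apply: contra yx => zx; rewrite /A -(component_eq zx) component_sym.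
- by [].
- move=> s t /TP [sS nts] /TP [tS' _]; apply: contra nts => st.
  by rewrite /nontrivial sS; apply/existsP; exists t; rewrite tS'.
- by move=> a aA b bB; rewrite adj_sym BA.
- by move=> a aA c cC; apply: (xanti c) => //; apply: component_refl.
- move=> a aA t /TP [tS' ntt]; apply: contra ntt => at_.
  by rewrite /nontrivial tS'; apply/existsP; exists a; rewrite AnS // adj_sym.
- apply: (dominating_vertex (d := y) Gf (component_connected xS) yanti xA).
    by move=> l lL; apply: LC.
  by move=> l /LS lS; apply: tS.
- by move=> l lL c cC; apply: LC.
- move=> t /TP [tS' ntt] c /CP [/nontrivial_notin cS _]; apply: contra ntt => tc.
  by rewrite /nontrivial tS'; apply/existsP; exists c; rewrite cS.
(* A nonadjacent pair [l], [b] would agree on [A], but [b] is complete to [A] and [l] is not. *)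
- move=> l lL b bB; apply/negPn/negP => lb.
  have [lS [z zA lz]] := incomplete_toP _ _ _ lL.
  have [w wA lw] := tS _ _ lS ntx; have [v vy bv] := tS _ _ (BS _ bB) nty.
  have vA : vanticomplete G v A by move=> u uA; rewrite adj_sym; apply: (xanti y).
  have lv : G l v by apply: (incomplete_complete tS ntx nty yx lL).
  have := nonadjacent_agree Gf (component_connected xS) vA lv bv lb wA lw xA
    (BA _ _ bB xA) zA.
  by rewrite (negPf lz) (BA _ _ bB zA).
- have [|||c cy cB] := dominating_vertex (D := component G S y) (M := B)
    (d := x) Gf (component_connected yS) _ (component_refl _ _ _).
  + by apply: (xanti y).
  + by move=> b bB; apply: BA.
  + by move=> b /BS bS; apply: tS.
  exists c => //; rewrite in_setD inE (nontrivial_component nty cy) andbT.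
  by apply: contra yx => zx; rewrite /A -(component_eq zx) component_sym.
(* Two nonadjacent vertices of [B] agree on the component of [c], with [x] as their common neighbour
   outside it. *)
move=> c b b' cC bB b'B bb'; have [ntc cA] := CP _ cC.
have [v vc bv] := tS _ _ (BS _ bB) ntc; have [v' vc' bv'] := tS _ _ (BS _ b'B) ntc.
rewrite ![G c _]adj_sym.
apply: (nonadjacent_agree Gf (component_connected (nontrivial_notin ntc)) _ (BA _ _ bB xA)
  (BA _ _ b'B xA) bb' vc bv vc' bv').
  exact: xanti.
exact: component_refl.
Qed.
End Divide.

Lemma clique_or_nonedge (V : finType) (G : sgraph V) (K : {set V}) :
  clique G K \/ exists u u', [/\ u \in K, u' \in K, u != u' & ~~ G u u'].
Proof.
have [/existsP [u /existsP [u' /and4P [? ? ? ?]]]|none] :=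
  boolP [exists u, [exists u', [&& u \in K, u' \in K, u != u' & ~~ G u u']]].
  by right; exists u, u'.
left=> u u' uK u'K ne; apply: contraNT none => n.
by apply/existsP; exists u; apply/existsP; exists u'; rewrite uK u'K ne.
Qed.

(** The start of a minimisation: every separating subset of this set leaves [W] and the edge [v v']
    untouched. *)
Lemma separates_seed (V : finType) (G : sgraph V) (W : {set V}) x x' v v' :
  x \in W -> x' \in W -> G x x' -> G v v' -> v \notin W ->
  vanticomplete G v W -> vanticomplete G v' W ->
  separates G x (~: (W :|: [set v; v'])).
Proof.
move=> xW x'W xx' vv' vW av av'; set S := ~: _.
have inS z : z \notin S = [|| z \in W, z == v | z == v'] by rewrite !inE negbK.
have sub : component G S x \subset W.
  apply: component_sub => // p q /and3P [_]; rewrite inS => qS pq pW.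
  case/or3P: qS => // /eqP e; move: pq; rewrite e adj_sym.
    by rewrite (negPf (av _ pW)).
  by rewrite (negPf (av' _ pW)).
apply/andP; split.
  by rewrite /nontrivial inS xW; apply/existsP; exists x'; rewrite inS x'W.
apply/existsP; exists v; rewrite (contra (subsetP sub v) vW) andbT.
by rewrite /nontrivial inS eqxx orbT; apply/existsP; exists v'; rewrite inS eqxx !orbT.
Qed.

(** The complement enters as a graph [H] equal to it pointwise, so that the lemma also applies with
    the two graphs exchanged. *)
Lemma two_edges_divide (V : finType) (G H : sgraph V) a b c d :
  H =2 compl G -> house_P5_C5_free G -> house_P5_C5_free H ->
  G a b -> G c d -> ~~ G a c -> ~~ G a d -> ~~ G b c -> ~~ G b d ->
  (exists A B C L T, split_divide G A B C L T) \/
  (exists A B C L T, split_divide H A B C L T).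
Proof.
move=> HE Gf Hf ab cd ac ad bc bd; have [nP nH nC] := Gf.
have sep : separates G a (~: ([set a; b] :|: [set c; d])).
  apply: (separates_seed (x' := b)); rewrite ?inE ?eqxx ?orbT //.
  - rewrite negb_or; apply/andP; split.
      by apply: contraNneq ad => <-.
    by apply: contraNneq bd => <-.
  - by move=> z; rewrite !inE => /orP [] /eqP ->; adjdone.
  by move=> z; rewrite !inE => /orP [] /eqP ->; adjdone.
have [S Smin _] := minset_exists sep.
have /andP [ntx /existsP [y /andP [nty yx]]] := minsetp Smin.
have tS := minset_touching Smin.
have xS := nontrivial_notin ntx; have yS := nontrivial_notin nty.
have xy : a \notin component G S y by rewrite component_sym.
have [cl|[u [u' [uL u'L uu' nuu']]]] :=
  clique_or_nonedge G (incomplete_to G S (component G S a)).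
  by left; apply: (component_split_divide Gf tS ntx nty).
have [cl|[v [v' [vL v'L vv' nvv']]]] :=
  clique_or_nonedge G (incomplete_to G S (component G S y)).
  by left; apply: (component_split_divide Gf tS nty ntx).
right.
have ucomp w z : w \in incomplete_to G S (component G S a) ->
    nontrivial G S z -> z \notin component G S a -> G w z.
  by move=> wL ntz zx; apply: (incomplete_complete Gf tS ntx ntz zx wL); apply: component_refl.
have vcomp w z : w \in incomplete_to G S (component G S y) ->
    z \in component G S a -> G w z.
  by move=> wL; apply: (incomplete_complete Gf tS nty ntx xy wL).
have Dy z : z \in component G S y -> nontrivial G S z /\ z \notin component G S a.
  move=> zy; split; first exact: nontrivial_component zy.
  by apply: contra xy => za; rewrite -(component_eq zy) -component_sym.
(* Nonadjacent [w] and [w'] would agree on the component of [a], to which [w'] is complete and [w]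
   is not. *)
have cross w w' : w \in incomplete_to G S (component G S a) ->
    w' \in incomplete_to G S (component G S y) -> G w w'.
  move=> wL w'L; apply/negPn/negP => nww'.
  have [wS [p px wp]] := incomplete_toP _ _ _ _ wL.
  have [w'S _] := incomplete_toP _ _ _ _ w'L.
  have [q qx wq] := tS _ _ wS ntx; have [r ry w'r] := tS _ _ w'S nty.
  have [ntr rx] := Dy _ ry.
  have ra : vanticomplete G r (component G S a).
    by move=> z zx; rewrite adj_sym; apply: (component_anticomplete xS yS yx).
  have := nonadjacent_agree Gf (component_connected xS) ra (ucomp _ _ wL ntr rx) w'r nww'
    qx wq qx (vcomp _ _ w'L qx) px.
  by rewrite (negPf wp) vcomp.
have [vS [r ry vr]] := incomplete_toP _ _ _ _ vL.
have [v'S _] := incomplete_toP _ _ _ _ v'L.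
have [e ey ve] := tS _ _ vS nty; have [e' e'y v'e'] := tS _ _ v'S nty.
have [nte ex] := Dy _ ey.
(* The nonadjacent pair [v], [v'] agrees on the component of [y], so the neighbour [e] of [v] is
   common to both. *)
have v'e : G v' e.
  have aa : vanticomplete G a (component G S y).
    by apply: (component_anticomplete xS yS yx); apply: component_refl.
  have := nonadjacent_agree Gf (component_connected yS) aa (vcomp _ _ vL (component_refl _ _ _))
    (vcomp _ _ v'L (component_refl _ _ _)) nvv' ey ve e'y v'e' ey.
  by rewrite ve => <-.
(* In the complement, [W] is connected and anticomplete to the edge [v v']. *)
pose W := component G S a :|: [set e; u; u'].
have Wv w : w \in incomplete_to G S (component G S y) -> G w e -> vanticomplete H w W.
  move=> wL we z zW; rewrite HE /= /compl_rel negb_and !negbK; apply/orP; right; move: zW.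
  rewrite in_setU => /orP [/vcomp -> //|]; rewrite !inE -orbA => /or3P [] /eqP -> //.
    by rewrite adj_sym cross.
  by rewrite adj_sym cross.
have [uS [p px up]] := incomplete_toP _ _ _ _ uL.
have ae : H e a.
  rewrite HE /= /compl_rel; apply/andP; split.
    by apply: contraNneq ex => ->; apply: component_refl.
  by rewrite adj_sym; apply: (component_anticomplete xS yS yx) => //; apply: component_refl.
have sep' : separates H e (~: (W :|: [set v; v'])).
  apply: (separates_seed (x' := a)) => //.
  - by rewrite !inE eqxx ?orbT.
  - by rewrite in_setU component_refl.
  - by rewrite HE /= /compl_rel vv'.
  - rewrite in_setU negb_or (contraTN (component_notin xS (y := v)) vS) /=.
    rewrite !inE -orbA !negb_or; apply/and3P; split.
    + by apply: contraTneq vS => ->; apply: nontrivial_notin nte.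
    + by apply: contraTneq (cross _ _ uL vL) => ->; rewrite adj_irr.
    by apply: contraTneq (cross _ _ u'L vL) => ->; rewrite adj_irr.
  - exact: Wv.
  exact: Wv.
have [S' Smin' sub'] := minset_exists sep'.
have /andP [ntx' /existsP [y' /andP [nty' yx']]] := minsetp Smin'.
have tS' := minset_touching Smin'.
have xS' := nontrivial_notin ntx'.
have WS' z : z \in W -> z \notin S'.
  by move=> zW; apply/negP => /(subsetP sub'); rewrite in_setC in_setU zW.
have xy' : e \notin component H S' y' by rewrite component_sym.
(* The side [A] is built on [y'], not on [e]: the vertices mixed on the component of [y'] are then
   complete in [H] to that of [e], hence anticomplete to it in [G]. *)
apply: (component_split_divide Hf tS' nty' ntx' xy').
have inD z : z \in component G S a -> z \in component H S' e.
  move=> zx; apply: (component_step (WS' e _) (WS' z _) _ (component_refl _ _ _)).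
  - by rewrite !inE eqxx ?orbT.
  - by rewrite in_setU zx.
  rewrite HE /= /compl_rel; apply/andP; split.
    by apply: contraNneq ex => ->.
  by rewrite adj_sym; apply: (component_anticomplete xS yS yx).
have uD : u \in component H S' e.
  apply: (component_step (WS' p _) (WS' u _) _ (inD _ px)).
  - by rewrite in_setU px.
  - by rewrite !inE eqxx ?orbT.
  rewrite HE /= /compl_rel adj_sym up andbT.
  by apply: contraTneq uS => <-; apply: (component_notin xS px).
have anti s : s \in incomplete_to H S' (component H S' y') ->
    forall z, z \in component H S' e -> ~~ G s z /\ s != z.
  move=> sL z ze; have := incomplete_complete Hf tS' nty' ntx' xy' sL ze.
  by rewrite HE /= /compl_rel => /andP [].
(* Every vertex of [S] has a [G]-neighbour in the component of [a], which lies inside that of [e] in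
   [H]. *)
have nS s : s \in incomplete_to H S' (component H S' y') -> s \notin S.
  move=> sL; apply/negP => sS; have [z zx sz] := tS _ _ sS ntx.
  by have [] := anti s sL z (inD _ zx); rewrite sz.
(* An edge [s t] of [G] would put [s] in a nontrivial component of [G - S] other than that of [a];
   [u] is complete to such components, but [s] misses [u]. *)
move=> s t sL tL st; rewrite HE /= /compl_rel st /=; apply/negP => Gst.
have nts : nontrivial G S s.
  by rewrite /nontrivial nS //; apply/existsP; exists t; rewrite nS.
have [nsu _] := anti s sL u uD.
case/negP: nsu; rewrite adj_sym; apply: ucomp => //; apply/negP => sx.
by have [_] := anti s sL s (inD _ sx); rewrite eqxx.
Qed.

(** * Graphs without 2K2, C4 and C5 *)

Section FoldesHammer.
Variables (V : finType) (G : sgraph V).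
Hypothesis no_2K2 : forall a b c d, G a b -> G c d ->
  ~~ G a c -> ~~ G a d -> ~~ G b c -> ~~ G b d -> False.
Hypothesis no_C4 : forall a b c d, G a b -> G b c -> G c d -> G d a ->
  ~~ G a c -> ~~ G b d -> a != c -> b != d -> False.
Hypothesis no_C5 : forall a b c d e, ~~ pentagon G a b c d e.

Let cliqueb (K : {set V}) := [forall x in K, [forall y in K, (x != y) ==> G x y]].

Let cliquebP K : reflect (clique G K) (cliqueb K).
Proof.
apply: (iffP forall_inP) => [h x y xK yK xy|h x xK].
  by have /forall_inP /(_ y yK) := h x xK; rewrite xy.
by apply/forall_inP => y yK; apply/implyP; apply: h.
Qed.

Let clique_add (K : {set V}) x : clique G K -> vcomplete G x K -> clique G (x |: K).
Proof.
move=> cK xK y z; rewrite !inE => /predU1P [->|yK] /predU1P [->|zK] ne.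
- by rewrite eqxx in ne.
- exact: xK.
- by rewrite adj_sym; apply: xK.
exact: cK.
Qed.

Let nbr x : {set V} := [set y | G x y].
Let weight (K : {set V}) := \sum_(v in K) #|nbr v|.+1.

(* Maximality of [weight] makes [K] inclusion-maximal and prevents exchanges of
   a vertex of [K] for outside vertices of larger total degree. *)
Lemma foldes_hammer : split_graph G.
Proof.
have c0 : cliqueb set0 by apply/cliquebP => x y; rewrite inE.
case: (@arg_maxnP _ set0 cliqueb weight c0) => K /cliquebP cK Kmax.
have {}Kmax K' : clique G K' -> weight K' <= weight K by move/cliquebP; apply: Kmax.
exists K, (~: K); split; rewrite ?setUCr -?setI_eq0 ?setICr //.
(* It is enough to refute an edge outside [K] whose ends have nested non-neighbourhoods in [K]:
   incomparable ones give witnesses [p], [q] closing a 4-cycle with [x] and [y]. *)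
suff main x y : x \notin K -> y \notin K -> G x y ->
    (forall p, p \in K -> ~~ G x p -> ~~ G y p) -> False.
  move=> x y; rewrite !inE => xK yK; apply/negP => xy.
  have [/existsP [p /and3P [pK xp yp]]|none] :=
    boolP [exists p, [&& p \in K, ~~ G x p & G y p]]; last first.
    apply: (main x y) => // p pK xp; apply: contraNN none => yp.
    by apply/existsP; exists p; rewrite pK xp.
  apply: (main y x) => // [|q qK yq]; first by rewrite adj_sym.
  apply/negP => xq; apply: (no_C4 (a := x) (b := y) (c := p) (d := q)) => //.
  - by apply: cK => //; apply: contraNneq xp => ->.
  - by rewrite adj_sym.
  - by apply: contraNneq xK => ->.
  by apply: contraNneq yK => ->.
move=> xK yK xy nest.
have [p pK xp] : exists2 p, p \in K & ~~ G x p.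
  have [/exists_inP //|none] := boolP [exists p in K, ~~ G x p].
  have /Kmax : clique G (x |: K).
    apply: clique_add => // q qK; apply: contraNT none => xq.
    by apply/exists_inP; exists q.
  by rewrite /weight big_setU1 //= -[X in _ <= X]add0n leq_add2r.
have yp := nest p pK xp.
have uniq_p q : q \in K -> q != p -> G x q.
  move=> qK qp; apply/negPn/negP => xq.
  by apply: (no_2K2 xy (cK _ _ qK pK qp)) => //; apply: nest.
have wK : weight K = #|nbr p|.+1 + weight (K :\ p) by rewrite /weight (big_setD1 p).
have cK' : clique G (x |: (K :\ p)).
  apply: clique_add => [q r /setD1P [_ qK] /setD1P [_ rK]|q /setD1P [qp qK]].
    exact: cK.
  exact: uniq_p.
have xK' : x \notin K :\ p by rewrite !inE (negPf xK) andbF.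
(* If [y] misses a further [q] in [K], exchanging [p] for [x] bounds the degree of [x] by that of
   [p]; since [x] sees [y] and [p] does not, some neighbour [z] of [p] is missed by [x], and a C4 or
   C5 appears. *)
have [/exists_inP [q qK /andP [qp yq]]|none] := boolP [exists q in K, (q != p) && ~~ G y q].
  have xq := uniq_p q qK qp.
  have degx : #|nbr x| <= #|nbr p|.
    by have := Kmax _ cK'; rewrite wK /weight big_setU1 //= leq_add2r.
  have [/exists_inP [z]|none] := boolP [exists z in nbr p, ~~ G x z].
    rewrite inE => pz xz.
    have yz : G y z.
      by apply/negPn/negP => yz; apply: (no_2K2 xy pz).
    have pq : G p q by apply: cK => //; rewrite eq_sym.
    have [zq|zq] := boolP (G z q).
      apply: (no_C4 (a := x) (b := y) (c := z) (d := q)) => //.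
      - by rewrite adj_sym.
      - by apply: contraTneq pz => <-; rewrite adj_sym.
      by apply: contraNneq yK => ->.
    have /negP := no_C5 x y z p q; apply.
    by do 9! (apply/andP; split; first adjdone); adjdone.
  suff : #|nbr p| < #|nbr x| by rewrite ltnNge degx.
  apply: proper_card; apply/properP; split.
    apply/subsetP => z pz; rewrite inE; apply: contraNT none => xz.
    by apply/exists_inP; exists z.
  by exists y; rewrite inE // adj_sym.
(* Otherwise [p] can be exchanged for both [x] and [y], so its degree exceeds the sum of theirs, and
   a neighbour of [p] missed by both gives a 2K2. *)
have cK'' : clique G (y |: (x |: (K :\ p))).
  apply: clique_add => // q /setU1P [->|/setD1P [qp qK]]; first by rewrite adj_sym.
  by apply: contraNT none => yq; apply/exists_inP; exists q; rewrite ?qp.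
have yK' : y \notin x |: (K :\ p).
  by rewrite !inE (negPf yK) andbF orbF; apply: contraTneq xy => ->; rewrite adj_irr.
have := Kmax _ cK''; rewrite wK /weight !big_setU1 //= addnA leq_add2r addSnnS => deg.
have [/exists_inP [z]|none'] := boolP [exists z in nbr p, ~~ G x z && ~~ G y z].
  by rewrite inE => pz /andP [xz yz]; apply: (no_2K2 xy pz).
have : #|nbr p| <= #|nbr x :|: nbr y|.
  apply: subset_leq_card; apply/subsetP => z pz; rewrite !inE.
  by apply: contraNT none'; rewrite negb_or => h; apply/exists_inP; exists z.
rewrite leqNgt; apply/negP/negPn.
apply: leq_ltn_trans (leq_card_setU _ _) _.
by rewrite -ltnS; apply: leq_trans deg; rewrite addnC !addnS !ltnS.
Qed.
End FoldesHammer.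

(** * Pentagons *)

Definition module_set (V : finType) (G : sgraph V) (M : {set V}) : Prop :=
  [/\ 1 < #|M|, #|M| < #|V| &
      forall w x y, w \notin M -> x \in M -> y \in M -> G w x = G w y].

Section Pentagon.
Variables (V : finType) (G : sgraph V).
Hypotheses (nP : no_P5 G) (nH : no_house G).

(** The adjacency between [v] and [a] is left open, so that [a] counts as a clone of itself. *)
Definition clone (a b c d e v : V) : bool :=
  [&& G v b, G v e, ~~ G v c & ~~ G v d].

Lemma pentagon_rot a b c d e : pentagon G a b c d e -> pentagon G b c d e a.
Proof.
by rewrite /pentagon => /and5P [-> -> -> -> /and5P [-> -> -> -> /andP [-> ->]]].
Qed.

Lemma pentagon_attach a b c d e v : pentagon G a b c d e ->
  [|| [&& G v a, G v b, G v c, G v d & G v e],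
      ~~ [|| G v a, G v b, G v c, G v d | G v e],
      clone a b c d e v, clone b c d e a v, clone c d e a b v, clone d e a b c v
    | clone e a b c d v].
Proof.
(* [R1] excludes the P5 [v - p - t - s - r], and [R2] the house on the cycle [t v q p] with roof
   [s]. Their ten rotated instances rule out every other attachment. *)
have R1 p q r s t : pentagon G p q r s t -> ~~ [&& G v p, ~~ G v t, ~~ G v s & ~~ G v r].
  case/and5P=> pq qr rs st /and5P [tp pr qs rt /andP [sp tq]].
  apply/negP => /and4P [h1 h2 h3 h4].
  by apply: (nP (a := v) (b := p) (c := t) (d := s) (e := r)); adjdone.
have R2 p q r s t : pentagon G p q r s t -> ~~ [&& ~~ G v p, G v s, G v q & G v t].
  case/and5P=> pq qr rs st /and5P [tp pr qs rt /andP [sp tq]].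
  apply/negP => /and4P [h1 h2 h3 h4].
  by apply: (nH (a := t) (b := v) (c := q) (d := p) (e := s)); adjdone.
move=> Pa; have Pb := pentagon_rot Pa; have Pc := pentagon_rot Pb.
have Pd := pentagon_rot Pc; have Pe := pentagon_rot Pd.
move: (R1 _ _ _ _ _ Pa) (R1 _ _ _ _ _ Pb) (R1 _ _ _ _ _ Pc).
move: (R1 _ _ _ _ _ Pd) (R1 _ _ _ _ _ Pe).
move: (R2 _ _ _ _ _ Pa) (R2 _ _ _ _ _ Pb) (R2 _ _ _ _ _ Pc).
move: (R2 _ _ _ _ _ Pd) (R2 _ _ _ _ _ Pe).
rewrite /clone.
by case: (G v a); case: (G v b); case: (G v c); case: (G v d); case: (G v e).
Qed.

Lemma clone_pentagon a b c d e v : pentagon G a b c d e -> clone a b c d e v ->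
  pentagon G v b c d e.
Proof.
case/and5P=> pq qr rs st /and5P [tp pr qs rt /andP [sp tq]] /and4P [h1 h2 h3 h4].
by do 9! (apply/andP; split; first adjdone); adjdone.
Qed.

(** Since [v] can replace [a], [w] attaches to two pentagons sharing [b], [c], [d], [e]; comparing
    the allowed attachments gives the claim. *)
Lemma clone_agree a b c d e v w : pentagon G a b c d e -> clone a b c d e v ->
  ~~ clone a b c d e w -> G w v = G w a.
Proof.
move=> P cv; have := pentagon_attach w (clone_pentagon P cv); have := pentagon_attach w P.
rewrite /clone.
by case: (G w a); case: (G w v); case: (G w b); case: (G w c); case: (G w d); case: (G w e).
Qed.

Lemma clone_self a b c d e : pentagon G a b c d e -> clone a b c d e a.
Proof.
case/and5P=> pq qr rs st /and5P [tp pr qs rt /andP [sp tq]].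
by do 3! (apply/andP; split; first adjdone); adjdone.
Qed.

Lemma clone_module a b c d e v : pentagon G a b c d e -> clone a b c d e v ->
  v != a -> module_set G [set w | clone a b c d e w].
Proof.
move=> P cv va; split.
- by apply/card_gt1P; exists v, a; rewrite !inE cv (clone_self P).
- rewrite -cardsT; apply: proper_card; apply/properP; split; first exact: subsetT.
  by exists b; rewrite !inE // /clone adj_irr.
by move=> w x y; rewrite !inE => cw cx cy; rewrite !(clone_agree P).
Qed.

(** If [v] is a clone of a pentagon vertex, the clones of that vertex form a module. Otherwise the
    clones of all five vertices do: a vertex outside is complete or anticomplete to the pentagon,
    and [v] keeps the set proper. *)
Lemma pentagon_module a b c d e v : pentagon G a b c d e ->
  v \notin [:: a; b; c; d; e] -> exists M, module_set G M.
Proof.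
move=> Pa; rewrite !inE !negb_or => /and5P [va vb vc vd ve].
have Pb := pentagon_rot Pa; have Pc := pentagon_rot Pb.
have Pd := pentagon_rot Pc; have Pe := pentagon_rot Pd.
pose Z w := [|| clone a b c d e w, clone b c d e a w, clone c d e a b w,
  clone d e a b c w | clone e a b c d w].
have [/or4P [h|h|h|/orP [h|h]]|nZv] := boolP (Z v).
- by exists [set w | clone a b c d e w]; apply: clone_module h va.
- by exists [set w | clone b c d e a w]; apply: clone_module h vb.
- by exists [set w | clone c d e a b w]; apply: clone_module h vc.
- by exists [set w | clone d e a b c w]; apply: clone_module h vd.
- by exists [set w | clone e a b c d w]; apply: clone_module h ve.
have agree w x : ~~ Z w -> Z x -> G w x = G w a.
  move=> nZ; have := pentagon_attach w Pa.
  have := nZ; rewrite /Z !negb_or => /and5P [na nb nc nd ne].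
  rewrite (negPf na) (negPf nb) (negPf nc) (negPf nd) (negPf ne) !orbF => h.
  have [hb hc hd he] : [/\ G w b = G w a, G w c = G w a, G w d = G w a & G w e = G w a].
    by move: h; do 5 case: (G w _).
  case/or4P=> [cx|cx|cx|/orP [cx|cx]].
  + by rewrite (clone_agree Pa cx).
  + by rewrite (clone_agree Pb cx).
  + by rewrite (clone_agree Pc cx).
  + by rewrite (clone_agree Pd cx).
  by rewrite (clone_agree Pe cx).
exists [set w | Z w]; split.
- apply/card_gt1P; exists a, b; rewrite !inE /Z (clone_self Pa) (clone_self Pb) orbT.
  split=> //; apply: contraTneq Pa => ->; by rewrite /pentagon adj_irr.
- rewrite -cardsT; apply: proper_card; apply/properP; split; first exact: subsetT.
  by exists v; rewrite !inE.
by move=> w x y; rewrite !inE => cw cx cy; rewrite !agree.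
Qed.

Lemma pentagon_isomorphic a b c d e : pentagon G a b c d e ->
  (forall v, v \in [:: a; b; c; d; e]) -> isomorphic G C5.
Proof.
move=> P all5; apply: isomorphic_sym.
case/and5P: (P) => pq qr rs st /and5P [tp pr qs rt /andP [sp tq]].
pose f (i : 'I_5) := nth a [:: a; b; c; d; e] i.
have fM : {mono f : i j / C5 i j >-> G i j}.
  by apply: forall_ord5; apply: forall_ord5; rewrite /f /= ?adj_irr //;
    first [exact/negbTE | rewrite adj_sym //; exact/negbTE].
exists f => //; apply: inj_card_bij.
  apply: twin_free_inj fM => i j.
  by move: i j; apply: forall_ord5; apply: forall_ord5 => // h;
    first [by have := h (ord5 0) | by have := h (ord5 1) | by have := h (ord5 2)
          | by have := h (ord5 3) | by have := h (ord5 4)].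
rewrite card_ord cardE; apply: (@uniq_leq_size _ (enum V) [:: a; b; c; d; e]) => //.
exact: enum_uniq.
Qed.
End Pentagon.

(** * Reversing the operations *)

Section Pullback.
Variables (W V : finType) (h : W -> V) (G : sgraph V).

Lemma pullback_sym : symmetric (relpre h G).
Proof. by move=> x y; apply: adj_sym. Qed.

Lemma pullback_irr : irreflexive (relpre h G).
Proof. by move=> x; apply: adj_irr. Qed.

Definition pullback : sgraph W := SGraph pullback_sym pullback_irr.

Lemma embeds_pullback : embeds pullback G.
Proof. by exists h. Qed.
End Pullback.

Lemma module_substitution (V : finType) (G : sgraph V) (M : {set V}) :
  module_set G M ->
  exists (V0 W : finType) (G0 : sgraph V0) (x : V0) (H : sgraph W),
    [/\ isomorphic G (substitution G0 x H), embeds G0 G, embeds H G,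
        #|V0| < #|V| & #|W| < #|V|].
Proof.
case=> M1 MV Mu; have /card_gt0P [m mM] : 0 < #|M| by exact: ltnW.
(* [None] stands for the contracted module and takes its adjacencies from the representative [m]. *)
pose r (o : option {v | v \in ~: M}) := if o is Some u then val u else m.
exists (option {v | v \in ~: M}), {x | x \in M}, (pullback r G), None, (induced G M).
split; last 1 first.
- by rewrite card_sig.
- apply: isomorphic_sym.
  pose g (p : {v : option {v | v \in ~: M} | v != None} + {x | x \in M}) : V :=
    match p with inl u => r (val u) | inr s => val s end.
  have rM (u : {v : option {v | v \in ~: M} | v != None}) : r (val u) \notin M.
    by case: u => [[[v]|//]] /=; rewrite inE.
  exists g; last first.
    move=> [u|s] [v|t] //=; first by apply: (Mu (r (val u))) => //; apply: valP.
    by rewrite ![G _ (r _)]adj_sym; apply: (Mu (r (val v))) => //; apply: valP.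
  apply: inj_card_bij; last first.
    rewrite card_sum !card_sig; rewrite (cardC1 None) card_option card_sig /=.
    by rewrite addnC cardsC.
  move=> [u|s] [v|t] /=.
  + case: u v => [[u|//] ?] [[v|//] ?] /= /val_inj uv; congr inl.
    by apply: val_inj; rewrite /= uv.
  + by move=> e; have := rM u; rewrite e (valP t).
  + by move=> e; have := rM v; rewrite -e (valP s).
  by move/val_inj ->.
- exact: embeds_pullback.
- exact: embeds_induced.
by rewrite card_option card_sig -(cardsC M) -[X in X < _]add1n ltn_add2r.
Qed.

Section DivideUnification.
Variables (V : finType) (G : sgraph V) (A B C L T : {set V}).
Hypothesis div : split_divide G A B C L T.
Variables (x0 y0 : V).
Hypotheses (x0A : x0 \in A) (x0L : vcomplete G x0 L).
Hypotheses (y0C : y0 \in C) (y0B : vcomplete G y0 B).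

(* The marker vertices [a*] and [c*] are twins of [x0] and [y0]. *)
Let retract (u : V + bool) : V :=
  match u with inl v => v | inr true => x0 | inr false => y0 end.
Let GU := pullback retract G.
Let lift (X : {set V}) : {set V + bool} :=
  [set u | if u is inl v then v \in X else false].
Let a : V + bool := inr true.
Let c : V + bool := inr false.

Let lift_disjoint (X Y : {set V}) : [disjoint X & Y] -> [disjoint lift X & lift Y].
Proof.
rewrite -!setI_eq0 => /eqP XY; apply/eqP/setP => -[v|b]; rewrite !inE //.
by rewrite -in_setI XY inE.
Qed.

Let lift_card (X : {set V}) : #|lift X| = #|X|.
Proof.
rewrite -(card_imset _ (@inl_inj V bool)); apply: eq_card => -[v|b].
  by rewrite inE mem_imset //; apply: inl_inj.
by rewrite inE; apply/esym/negP => /imsetP [].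
Qed.

Let lift_composable :
  composable GU GU (lift A) (lift B) (lift C) (lift L) (lift T) a c.
Proof.
split.
- have := divide_disj div; rewrite /= !andbT.
  move=> /and4P [/and4P [? ? ? ?] /and3P [? ? ?] /andP [? ?] ?].
  by rewrite !lift_disjoint.
- by apply/set0Pn; exists (inl x0); rewrite inE.
- by apply/set0Pn; exists (inl y0); rewrite inE.
- by [].
- by rewrite !inE.
- by rewrite !inE.
- move=> [x|x] [y|y]; rewrite !inE // => xL yL xy.
  by apply: (divide_L div) => //; apply: contraNneq xy => ->.
- by move=> [x|x] [y|y]; rewrite !inE // => xT yT; apply: (divide_T div).
- by move=> [x|x] xA [y|y]; rewrite !inE // in xA * => yB; apply: (divide_AB div).
- by move=> [x|x] xA [y|y]; rewrite !inE // in xA * => yB; apply: (divide_AT div).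
- exists (inl x0); first by rewrite inE.
  by move=> [y|y]; rewrite !inE // => yL; apply: x0L.
- move=> [y|y]; rewrite !inE // => /orP [yB|yL]; first exact: y0B.
  by rewrite adj_sym; apply: (divide_LC div).
- move=> [y|y]; rewrite !inE // => /orP [yA|yT]; rewrite adj_sym.
    exact: (divide_AC div).
  exact: (divide_TC div).
- by [].
- by move=> [x|x] xA [y|y]; rewrite !inE // in xA * => yB; apply: (divide_TC div).
- move=> [x|x] xA [y|y]; rewrite !inE // in xA * => /orP [] yB.
    exact: (divide_LB div).
  exact: (divide_LC div).
- move=> [y|y]; rewrite !inE // => /orP [yB|yL]; first exact: (divide_AB div).
  exact: x0L.
- move=> [y|y]; rewrite !inE // => /orP [yC|yT]; first exact: (divide_AC div).
  exact: (divide_AT div).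
- exists (inl y0); first by rewrite inE.
  by move=> [y|y]; rewrite !inE // => yB; apply: y0B.
move=> x X xC [b bB ->].
(* [divide_agree] handles one nonadjacent pair of [B] and propagates along paths of the complement,
   so [x] is not mixed on the anticomponent. *)
have cst y : connect (anti_rel GU (lift B)) b y -> GU x y = GU x b.
  have sym : connect_sym (anti_rel GU (lift B)).
    by apply: sym_connect_sym => p q; rewrite /anti_rel adj_sym andbCA.
  have cl p q : anti_rel GU (lift B) p q ->
      p \in [pred z | GU x z == GU x b] -> q \in [pred z | GU x z == GU x b].
    rewrite !inE; case/and3P=> pB qB /andP [_ pq] /eqP <-; apply/eqP.
    move: x p q xC pB qB pq => [x|x] [p|p] [q|q]; rewrite !inE // => xC pB qB pq.
    by apply: (divide_agree div) => //=; rewrite adj_sym.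
  move=> by_; have := closed_connect (intro_closed sym cl) by_.
  by rewrite !inE eqxx => /esym /eqP.
case; case xb: (GU x b) => h1 h2.
  by apply: h1 => y; rewrite inE => /andP [_ /cst ->].
by apply: h2 => y; rewrite inE => /andP [_ /cst ->]; rewrite xb.
Qed.

Let cover v : [|| v \in A, v \in B, v \in C, v \in L | v \in T].
Proof. by have := in_setT v; rewrite -(divide_cover div) !inE -!orbA. Qed.

Let lift_isomorphic : isomorphic G
  (split_unification GU GU (lift A) (lift B) (lift C) (lift L) (lift T)).
Proof.
have inZ v : inl v \in lift A :|: lift B :|: lift C :|: lift L :|: lift T.
  by rewrite !inE -!orbA.
exists (fun v => exist _ (inl v) (inZ v)).
  exists (fun u => retract (val u)) => [//|[[v|b] h]]; apply: val_inj => //=.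
  by move: h; rewrite !inE.
move=> x y; rewrite /split_unification /= /induced_rel /= /unif_rel !inE /=.
(* Two vertices lie in no common part only when one is in [A] and the other in [C]; such a pair is
   nonadjacent. *)
have := cover x; have := cover y.
have := @divide_AC _ _ _ _ _ _ _ div x; have := @divide_AC _ _ _ _ _ _ _ div y.
case: (boolP (G x y)) => [xy|]; last by rewrite !andbF.
move=> /(_ _ x) ACy /(_ _ y) ACx.
case: (boolP (x \in A)) ACx => xA.
  move=> /(_ isT); case: (boolP (y \in C)) => yC; first by rewrite xy => /(_ isT).
  by move=> _; case: (y \in A); case: (y \in B); case: (y \in L); case: (y \in T).
move=> _; case: (boolP (x \in C)) ACy => xC.
  case: (boolP (y \in A)) => yA; first by move=> /(_ isT isT); rewrite adj_sym xy.
  move=> _; case: (y \in C); case: (y \in B); case: (y \in L); case: (y \in T);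
    by rewrite /= ?orbT.
move=> _; case: (x \in B); case: (x \in L); case: (x \in T) => //=;
  by case: (y \in A); case: (y \in B); case: (y \in C); case: (y \in L); case: (y \in T).
Qed.

(** The part drops [Y], of at least two vertices, and gains a single marker. *)
Let card_part (X Y : {set V}) (S : {set V + bool}) u : [disjoint X & Y] -> 1 < #|Y| ->
  S = lift X :|: [set u] -> #|S| < #|V|.
Proof.
move=> XY Y1 ->; apply: (@leq_ltn_trans (#|X| + 1)).
  by rewrite -(lift_card X) -(cards1 u) leq_card_setU.
have : #|X| + #|Y| <= #|V|.
  by rewrite -cardsUI; move: XY; rewrite -setI_eq0 => /eqP ->; rewrite cards0 addn0 max_card.
by apply: leq_trans; rewrite ltn_add2l.
Qed.

Lemma lift_unification :
  exists (U : finType) (G1 : sgraph U) (A' B' C' L' T' : {set U}) (a c : U),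
    [/\ composable G1 G1 A' B' C' L' T' a c,
        isomorphic G (split_unification G1 G1 A' B' C' L' T'),
        embeds (part1 G1 A' B' L' T' c) G,
        embeds (part2 G1 B' C' L' T' a) G
      & #|A' :|: B' :|: L' :|: T' :|: [set c]| < #|V| /\
        #|B' :|: C' :|: L' :|: T' :|: [set a]| < #|V| ].
Proof.
exists (V + bool)%type, GU, (lift A), (lift B), (lift C), (lift L), (lift T), a, c.
split=> //.
- exact: embeds_trans (embeds_induced _ _) (embeds_pullback _ _).
- exact: embeds_trans (embeds_induced _ _) (embeds_pullback _ _).
have := divide_disj div; rewrite /= !andbT -!setI_eq0.
move=> /and4P [/and4P [/eqP AB /eqP AC /eqP AL /eqP AT]].
move=> /and3P [/eqP BC _ _] /andP [/eqP CL /eqP CT] _.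
split.
  apply: (@card_part (A :|: B :|: L :|: T) C _ c _ (divide_C div)).
    by rewrite -setI_eq0 !setIUl AC BC ![_ :&: C]setIC CL CT !setU0.
  by apply/setP => -[v|b]; rewrite !inE.
apply: (@card_part (B :|: C :|: L :|: T) A _ a _ (divide_A div)).
  by rewrite -setI_eq0 setIC !setIUr AB AC AL AT !setU0.
by apply/setP => -[v|b]; rewrite !inE.
Qed.
End DivideUnification.

Lemma split_divide_unification (V : finType) (G : sgraph V) :
  (exists A B C L T, split_divide G A B C L T) ->
  exists (U : finType) (G1 : sgraph U) (A B C L T : {set U}) (a c : U),
    [/\ composable G1 G1 A B C L T a c,
        isomorphic G (split_unification G1 G1 A B C L T),
        embeds (part1 G1 A B L T c) G,
        embeds (part2 G1 B C L T a) G
      & #|A :|: B :|: L :|: T :|: [set c]| < #|V| /\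
        #|B :|: C :|: L :|: T :|: [set a]| < #|V| ].
Proof.
case=> A [B [C [L [T div]]]].
have [x xA xL] := divide_AL div; have [y yC yB] := divide_CB div.
exact: (lift_unification div xA xL yC yB).
Qed.

(** * Decomposition of free graphs and the final induction *)

Lemma free_house_P5_C5_free (V : finType) (G : sgraph V) : P5_antiP5_free G ->
  (forall a b c d e, ~~ pentagon G a b c d e) ->
  house_P5_C5_free G /\ house_P5_C5_free (compl G).
Proof.
move=> Gf nC; have Hf := compl_free Gf; split; split=> //;
  try exact: free_no_P5; try exact: free_no_house.
move=> a b c d e; apply/negP => /compl_pentagon.
exact/negP.
Qed.

Lemma split_or_divide (V : finType) (G : sgraph V) : P5_antiP5_free G ->
  (forall a b c d e, ~~ pentagon G a b c d e) ->
  [\/ split_graph G, exists A B C L T, split_divide G A B C L T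
    | exists A B C L T, split_divide (compl G) A B C L T].
Proof.
move=> Gf nC; have [G3 H3] := free_house_P5_C5_free Gf nC.
have [/existsP [[[a b] [c d]] /and5P [ab cd ac ad /andP [bc bd]]]|n2] := boolP
  [exists q : (V * V) * (V * V), [&& G q.1.1 q.1.2, G q.2.1 q.2.2,
    ~~ G q.1.1 q.2.1, ~~ G q.1.1 q.2.2, ~~ G q.1.2 q.2.1 & ~~ G q.1.2 q.2.2]].
  have [] := two_edges_divide (fun _ _ => erefl) G3 H3 ab cd ac ad bc bd => h;
    by [apply: Or32|apply: Or33].
have [/existsP [[[a b] [c d]] /and5P [/= ab bc cd da /and4P [ac bd ne1 ne2]]]|n4] := boolP
  [exists q : (V * V) * (V * V), [&& G q.1.1 q.1.2, G q.1.2 q.2.1,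
    G q.2.1 q.2.2, G q.2.2 q.1.1, ~~ G q.1.1 q.2.1, ~~ G q.1.2 q.2.2, q.1.1 != q.2.1
    & q.1.2 != q.2.2]].
  have nE x y : G x y -> ~~ compl G x y by rewrite /= /compl_rel => ->; rewrite andbF.
  have GE : G =2 compl (compl G).
    move=> x y; rewrite /= /compl_rel /= /compl_rel.
    by case: eqP => [->|_] /=; rewrite ?adj_irr ?negbK.
  (* The diagonals of an induced 4-cycle are two anticomplete edges of the complement. *)
  have := two_edges_divide (a := a) (b := c) (c := b) (d := d) GE H3 G3.
  case; rewrite ?nE //= /compl_rel ?ac ?bd ?andbT //; try by rewrite adj_sym.
    by move=> h; apply: Or33.
  by move=> h; apply: Or32.
apply: Or31; apply: foldes_hammer nC.
  move=> a b c d ab cd ac ad bc bd; case/negP: n2; apply/existsP.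
  by exists ((a, b), (c, d)); rewrite /= ab cd ac ad bc.
move=> a b c d ab bc cd da ac bd ne1 ne2; case/negP: n4; apply/existsP.
by exists ((a, b), (c, d)); rewrite /= ab bc cd da ac bd ne1.
Qed.

Lemma free_generated (V : finType) (G : sgraph V) : P5_antiP5_free G -> generated G.
Proof.
have [n] := ubnP #|V|; elim: n V G => // n IH V G; rewrite ltnS => Vn Gf.
have IHe (W : finType) (H : sgraph W) : #|W| < #|V| -> embeds H G -> generated H.
  move=> WV HG; apply: IH (leq_trans WV Vn) _.
  exact: P5_antiP5_free_embeds Gf.
have [/existsP [[[[[a b] c] d] e] P]|nC] := boolP
    [exists q : V * V * V * V * V, pentagon G q.1.1.1.1 q.1.1.1.2 q.1.1.2 q.1.2 q.2].
  have [/forallP al|] := boolP [forall v, v \in [:: a; b; c; d; e]].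
    by apply: gen_pentagon; apply: pentagon_isomorphic P al.
  rewrite negb_forall => /existsP [v nv].
  have [M /module_substitution] := pentagon_module (free_no_P5 Gf) (free_no_house Gf) P nv.
  case=> V0 [W [G0 [x [H [iso e0 eH c0 cW]]]]].
  exact: gen_subst (IHe _ _ c0 e0) (IHe _ _ cW eH) iso.
have {}nC a b c d e : ~~ pentagon G a b c d e.
  by apply: contra nC => P; apply/existsP; exists (a, b, c, d, e).
case: (split_or_divide Gf nC); first exact: gen_split.
  case/split_divide_unification=> U [G1 [A [B [C [L [T [a [c [cmp iso e1 e2 [c1 c2]]]]]]]]]].
  by apply: gen_unif cmp _ _ iso; [apply: IHe e1|apply: IHe e2]; rewrite card_sig.
case/split_divide_unification=> U [G1 [A [B [C [L [T [a [c [cmp iso e1 e2 [c1 c2]]]]]]]]]].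
have IHc (W : finType) (H : sgraph W) :
    #|W| < #|V| -> embeds H (compl G) -> generated (compl H).
  move=> WV HG; apply: IH (leq_trans WV Vn) _; apply: compl_free.
  exact: P5_antiP5_free_embeds HG (compl_free Gf).
by apply: gen_counif cmp _ _ iso; [apply: IHc e1|apply: IHc e2]; rewrite card_sig.
Qed.

Theorem theorem5p2 (V : finType) (G : sgraph V) :
  P5_antiP5_free G <-> generated G.
Proof. by split; [apply: free_generated | apply: generated_free]. Qed.
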